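(* Let $d\geq 1$ and let $\mathcal{C}$ be a $d$-arrangement of $k\geq 3$ curves in $\mathbb{P}^2_{\mathbb{C}}$ having $s$ intersection points and such that $t_k=0$. Let $\Bbbk$ be a field, $S=\Bbbk[x_1,\dots,x_s,y_1,\dots,y_k]$, and let $I(G)\subset S$ be the edge ideal of the Levi graph $G$ of $\mathcal{C}$. Then $$\left\lceil\frac{s+k}{2}\right\rceil\leq \mathrm{pd}(S/I(G))\leq (s+k)\left(1-\frac{1}{2d^2(k-1)}\right),$$ where $\mathrm{pd}$ denotes the projective dimension over $S$.
   Context: An arrangement $\mathcal{C}=\{C_1,\dots,C_k\}$ of $k\geq 3$ (distinct) curves in $\mathbb{P}^2_{\mathbb{C}}$ is a $d$-arrangement if all $C_i$ are smooth of the same degree $d\geq 1$ and all points of $\mathrm{Sing}(\mathcal{C})$ are ordinary intersection points, i.e. they look locally like intersections of lines (the curves through the point have pairwise distinct tangents there). Here $\mathrm{Sing}(\mathcal{C})$ is the set of intersection points, i.e. points lying on at least two curves of $\mathcal{C}$. Write $\mathrm{Sing}(\mathcal{C})=\{p_1,\dots,p_s\}$. For $r\geq 2$, $t_r$ is the number of points lying on exactly $r$ curves of $\mathcal{C}$; so $t_k=0$ means that no point lies on all $k$ curves. The Levi graph $G$ of $\mathcal{C}$ is the bipartite graph with vertex set $\{x_1,\dots,x_s\}\cup\{y_1,\dots,y_k\}$ in which $x_j$ and $y_i$ are joined by an edge if and only if $p_j\in C_i$. Its edge ideal $I(G)$ is the ideal generated by all $x_jy_i$ such that $x_j$ and $y_i$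 are adjacent. *)

(* Defs.v *)
From HB Require Import structures.
From mathcomp Require Import all_boot all_order all_algebra.
From mathcomp Require Import generic_quotient ring_quotient.
From mathcomp Require Import boolp classical_sets reals complex.
From mathcomp Require Import mpoly.

Set Implicit Arguments.
Unset Strict Implicit.
Unset Printing Implicit Defensive.

Import Order.TTheory GRing.Theory Num.Theory.
Local Open Scope ring_scope.
Local Open Scope quotient_scope.
Local Open Scope classical_set_scope.

Section IdealQuotientModule.
Variables (R : comNzRingType) (I : idealr R).
Implicit Types (a b : R) (x y : {ideal_quot I}).

Definition quot_scale a x : {ideal_quot I} := \pi_({ideal_quot I}) a * x.

Fact quot_scaleA a b x :
  quot_scale a (quot_scale b x) = quot_scale (a * b) x.
Proof. by rewrite /quot_scale rmorphM mulrA. Qed.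

Fact quot_scale1 : left_id 1 quot_scale.
Proof. by move=> x; rewrite /quot_scale rmorph1 mul1r. Qed.

Fact quot_scaleDr : right_distributive quot_scale +%R.
Proof. by move=> a x y; rewrite /quot_scale mulrDr. Qed.

Fact quot_scaleDl x : {morph quot_scale^~ x : a b / a + b}.
Proof. by move=> a b; rewrite /quot_scale rmorphD mulrDl. Qed.

HB.instance Definition _ := GRing.Zmodule_isLmodule.Build R {ideal_quot I}
  quot_scaleA quot_scale1 quot_scaleDr quot_scaleDl.

End IdealQuotientModule.

Section ProjectiveDimension.
Variable R : nzRingType.

Definition projective (P : lmodType R) : Prop :=
  forall (M N : lmodType R) (g : {linear M -> N}) (f : {linear P -> N}),
    (forall y, exists x, g x = y) ->
    exists h : {linear P -> M}, forall x, g (h x) = f x.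

Record proj_resolution (M : lmodType R) := ProjResolution {
  pr_mod :> nat -> lmodType R;
  pr_diff : forall i, {linear pr_mod i.+1 -> pr_mod i};
  pr_aug : {linear pr_mod 0%N -> M};
  pr_projective : forall i, projective (pr_mod i);
  pr_aug_surj : forall y, exists x, pr_aug x = y;
  pr_exact0 : forall x, pr_aug x = 0 <-> exists y, pr_diff 0%N y = x;
  pr_exactS : forall i x,
    pr_diff i x = 0 <-> exists y, pr_diff i.+1 y = x
}.

Definition has_resolution_le (M : lmodType R) (n : nat) : Prop :=
  exists P : proj_resolution M,
    forall i, (n < i)%N -> forall x : P i, x = 0.

(* [is_projdim M n] says that pd(M) is finite and equal to n.                *)
(* (The zero module gets projective dimension 0.)                            *)
Definition is_projdim (M : lmodType R) (n : nat) : Prop :=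
  has_resolution_le M n /\ forall m, has_resolution_le M m -> (n <= m)%N.

End ProjectiveDimension.

Section EdgeIdeal.
Variables (K : fieldType) (n : nat).
Implicit Types e : rel 'I_n.

Definition edge_ideal e : {pred {mpoly K[n]}} := fun p =>
  `[< exists c : 'I_n -> 'I_n -> {mpoly K[n]},
        p = \sum_u \sum_(v | e u v) c u v * ('X_u * 'X_v) >].

Fact edge_ideal_closed e : idealr_closed (edge_ideal e).
Proof.
split.
- apply/asboolP; exists (fun _ _ => 0).
  by rewrite big1 // => u _; rewrite big1 // => v _; rewrite mul0r.
- apply/negP => /asboolP[c] /(congr1 (meval (fun=> 0))) /eqP.
  rewrite meval1 raddf_sum big1 ?oner_eq0 // => u _.
  by rewrite raddf_sum big1 // => v _; rewrite /= !mevalM !mevalXU !mulr0.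
- move=> a p q /asboolP[c ->] /asboolP[c' ->]; apply/asboolP.
  exists (fun u v => a * c u v + c' u v).
  rewrite mulr_sumr -big_split; apply: eq_bigr => u _ /=.
  rewrite mulr_sumr -big_split; apply: eq_bigr => v _ /=.
  by rewrite mulrDl !mulrA.
Qed.

HB.instance Definition _ e :=
  isIdealr.Build {mpoly K[n]} (edge_ideal e) (edge_ideal_closed e).

(* S/I(G) as a module over S = K[x_0, ..., x_(n-1)], not over K.             *)
Definition edge_quotient e : lmodType {mpoly K[n]} :=
  {ideal_quot (edge_ideal e)}.

End EdgeIdeal.

Section PlaneCurves.
Variable F : fieldType.

(* Points of the projective plane are the lines through the origin of F^3.   *)
Definition P2 := {L : {vspace 'rV[F]_3} | \dim L == 1%N}.

Implicit Types (f : {mpoly F[3]}) (q : P2).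

Definition curve f : set P2 :=
  [set q : P2 | forall v : 'rV[F]_3, v \in val q -> f.@[v 0] = 0].

Definition smooth f : Prop :=
  forall v : 'rV[F]_3, v != 0 -> f.@[v 0] = 0 ->
    exists i : 'I_3, (f^`M(i)).@[v 0] != 0.

(* The projective tangent line at q; it is meaningful when f is homogeneous  *)
(* and q is a smooth point of the curve f = 0.                               *)
Definition tangent f q : set P2 :=
  [set q' : P2 | forall v w : 'rV[F]_3, v \in val q -> w \in val q' ->
     \sum_(i < 3) (f^`M(i)).@[v 0] * w 0 i = 0].

Section Arrangement.
Variables (k : nat) (C : 'I_k -> {mpoly F[3]}).

Definition Sing : set P2 :=
  [set q | exists i j, [/\ i != j, curve (C i) q & curve (C j) q]].

Record d_arrangement (d : nat) : Prop := DArrangement {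
  arr_homog : forall i, C i \is d.-homog;
  arr_smooth : forall i, smooth (C i);
  arr_distinct : injective (fun i => curve (C i));
  arr_ordinary : forall q i j, i != j -> curve (C i) q -> curve (C j) q ->
    tangent (C i) q <> tangent (C j) q
}.

Section Levi.
Variables (s : nat) (p : 'I_s -> P2).

Definition t_ (r : nat) : nat :=
  #|[pred j : 'I_s | #|[pred i : 'I_k | p j \in curve (C i)]| == r]|.

(* Vertices 0, ..., s-1 are the points and s, ..., s+k-1 are the curves.     *)
Definition levi_graph : rel 'I_(s + k) := fun u v =>
  match fintype.split u, fintype.split v with
  | inl j, inr i | inr i, inl j => p j \in curve (C i)
  | _, _ => false
  end.

End Levi.
End Arrangement.
End PlaneCurves.

(* Main.v *)
From HB Require Import structures.
Require Import Defs.
From mathcomp Require Import boolp classical_sets reals complex.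
From mathcomp Require Import all_boot all_order all_algebra.
From mathcomp Require Import generic_quotient ring_quotient.
From mathcomp Require Import freeg mpoly.
From mathcomp Require Import zify ring.

(** Write n = s + k and Delta = d^2 (k-1).

    Both bounds are combinatorial once two facts of plane geometry are known:
    a curve of the arrangement meets every other one, in at most d^2 points
    ([meet_nonempty], [card_meet]).  Hence the Levi graph has no isolated
    vertex and, since no point lies on all k curves, all its degrees are at
    most Delta.

    Upper bound ([pdle_graph]).  The short exact sequence
    0 -> S/(I : x) -> S/I -> S/(I + x) -> 0 gives
    pd (S/I) <= max (pd (S/(I : x)), pd (S/(I + x))).  For an edge ideal and a
    vertex x, passing to I + x deletes x from the graph and adds one variable to
    the ideal, while passing to I : x deletes x and all its neighbours and adds
    only the neighbours as variables; each variable raises pd by one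
    ([pdle_addvar]).  If the neighbours of a fixed vertex w are deleted one
    after the other, then along every branch of the resulting tree either a
    colon is taken or w becomes isolated and is deleted for free.  So when a
    variables have been added, at least a + 1 vertices are gone, and
    a < 2 Delta; summing up, 2 Delta pd <= (2 Delta - 1) n.

    Lower bound ([edge_pdle_lower]).  The product of all y-variables is not in I,
    but is killed modulo I by each x-variable, because every point lies on a
    curve.  A nonzero element killed by a regular sequence of length s forces
    pd >= s ([socle_pdle]); this is the special case of the
    Auslander-Buchsbaum formula that is needed here, and it is proved by
    following the vanishing of Koszul cohomology along the syzygies.
    Symmetrically pd >= k, and max (s, k) >= (s + k) / 2.

    The geometric facts come from elimination theory.  Project from a point c on
    neither curve; the resultant along the lines through c, restricted to a
    pencil u + x v, is a polynomial in x whose zeros are the directions of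
    common points.  Exchanging u and v reverses it as a polynomial of degree
    d^2 ([eliminant_swap]), so its degree is at most d^2, and it cannot be a
    nonzero constant without its reversal vanishing at 0. *)

Set Implicit Arguments.
Unset Strict Implicit.
Unset Printing Implicit Defensive.

Import GRing.Theory Num.Theory.
Local Open Scope ring_scope.

(** * Modules of bounded projective dimension *)

Section Modules.
Variable R : nzRingType.
Implicit Types A B C K L M N P Q : lmodType R.

Definition surj M N (f : M -> N) : Prop := forall y, exists x, f x = y.

Definition mk_linear M N (f : M -> N) (fL : linear f) : {linear M -> N} :=
  HB.pack f (GRing.isLinear.Build R M N _ f fL).

Section Kernel.
Variables (M N : lmodType R) (f : {linear M -> N}).
Definition in_ker : {pred M} := fun x => f x == 0.
Fact in_ker_submod : submod_closed in_ker.
Proof.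
split; first by rewrite unfold_in /in_ker linear0.
move=> a x y; rewrite !unfold_in /in_ker => /eqP fx /eqP fy.
by rewrite linearP fx fy scaler0 addr0.
Qed.
HB.instance Definition _ :=
  GRing.isSubmodClosed.Build R M in_ker in_ker_submod.
(** Syzygies have to be modules themselves; as a subtype cut out by a boolean test,
    the kernel inherits the module structure of M. *)
Record ker_mod := KerMod { ker_val :> M; _ : ker_val \in in_ker }.
HB.instance Definition _ := [isSub for ker_val].
HB.instance Definition _ := [Choice of ker_mod by <:].
HB.instance Definition _ := [SubChoice_isSubLmodule of ker_mod by <:].
Lemma ker_valP (x : ker_mod) : f (val x) = 0.
Proof. by case: x => x /= /eqP. Qed.
End Kernel.

Definition ses A B C (i : {linear A -> B}) (g : {linear B -> C}) : Prop :=
  [/\ injective i, surj g & forall x, g x = 0 <-> exists y, i y = x].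

(** Left exactness of Hom (N, -): injectivity of i makes the pointwise choice
    of preimages linear. *)
Lemma factor_inj A B C (i : {linear A -> B}) (g : {linear B -> C}) N
    (h : {linear N -> B}) :
  ses i g -> (forall x, g (h x) = 0) ->
  exists h' : {linear N -> A}, forall x, i (h' x) = h x.
Proof.
case=> inji _ ex gh0.
have /choice[f fE] : forall x, exists y, i y = h x by move=> x; apply/ex.
suff fL : linear f by exists (mk_linear fL).
by move=> a x y; apply: inji; rewrite linearP !fE linearP.
Qed.

(** Maps out of a quotient; linearity holds because h does not see the choice
    of preimages. *)
Lemma factor_surj M N L (f : {linear M -> N}) (h : {linear M -> L}) :
  surj f -> (forall x, f x = 0 -> h x = 0) ->
  exists h' : {linear N -> L}, forall x, h' (f x) = h x.
Proof.
move=> /choice[s sE] fh.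
have fhE x y : f x = f y -> h x = h y.
  by move=> e; apply/subr0_eq; rewrite -linearB fh // linearB e subrr.
suff hL : linear (fun y => h (s y)).
  by exists (mk_linear hL) => x /=; apply: fhE; rewrite sE.
by move=> a x y; rewrite -linearP; apply: fhE; rewrite linearP !sE.
Qed.

Lemma inverse_lin M N (f : {linear M -> N}) :
  injective f -> surj f ->
  exists g : {linear N -> M}, (forall x, g (f x) = x) /\ forall y, f (g y) = y.
Proof.
move=> inj sf.
have [|g gE] := @factor_surj M N M f idfun sf.
  by move=> x fx0; apply: inj; rewrite fx0 linear0.
exists g; split=> // y; have [x <-] := sf y; by rewrite gE.
Qed.

Lemma ses_ker M N (f : {linear M -> N}) :
  surj f -> ses (val : {linear ker_mod f -> M}) f.
Proof.
move=> sf; split=> // [|x]; first exact: val_inj.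
split=> [fx0|[y <-]]; last exact: ker_valP.
have kx : x \in in_ker f by apply/eqP.
by exists (KerMod kx).
Qed.

Lemma projective_retract P Q (r : {linear P -> Q}) (s : {linear Q -> P}) :
  (forall x, r (s x) = x) -> projective P -> projective Q.
Proof.
move=> rs pP M N g f sg; have [h hE] := pP M N g (f \o r) sg.
by exists (h \o s) => x /=; rewrite hE /= rs.
Qed.

Lemma projective_iso P Q (f : {linear P -> Q}) :
  injective f -> surj f -> projective P -> projective Q.
Proof.
by move=> fi fs; have [g [_ fg]] := inverse_lin fi fs; apply: projective_retract fg.
Qed.

Lemma projective0 P : (forall x : P, x = 0) -> projective P.
Proof.
move=> P0 M N g f sg; exists \0 => x /=.
by rewrite (P0 x) !linear0.
Qed.

Fact pair_sum_lin M N L (f : {linear M -> L}) (g : {linear N -> L}) :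
  linear (fun x : M * N => f x.1 + g x.2).
Proof. by move=> a x y /=; rewrite !linearP scalerDr addrACA. Qed.
Definition pair_sum M N L f g : {linear (M * N)%type -> L} :=
  mk_linear (@pair_sum_lin M N L f g).

Fact in_left_lin M N : linear (fun x : M => (x, 0) : M * N).
Proof. by move=> a x y; apply: injective_projections; rewrite /= ?scaler0 ?addr0. Qed.
Definition in_left M N : {linear M -> (M * N)%type} := mk_linear (@in_left_lin M N).

Fact in_right_lin M N : linear (fun x : N => (0, x) : M * N).
Proof. by move=> a x y; apply: injective_projections; rewrite /= ?scaler0 ?addr0. Qed.
Definition in_right M N : {linear N -> (M * N)%type} := mk_linear (@in_right_lin M N).

Lemma projective_prod P Q : projective P -> projective Q -> projective (P * Q)%type.
Proof.
move=> pP pQ M N g f sg.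
have [h hE] := pP _ _ g (f \o in_left P Q) sg.
have [k kE] := pQ _ _ g (f \o in_right P Q) sg.
exists (pair_sum h k) => x /=; rewrite linearD hE kE /= -linearD; congr (f _).
by apply: injective_projections; rewrite /= ?addr0 ?add0r.
Qed.

(** Projective dimension at most n, through iterated syzygies rather than whole
    resolutions, so that one can argue by induction on the bound;
    [pdle_of_resolution] and [resolution_of_pdle] show that the notions agree. *)
Fixpoint pdle n M : Prop :=
  if n is n'.+1 then
    exists (K P : lmodType R) (i : {linear K -> P}) (g : {linear P -> M}),
      [/\ ses i g, projective P & pdle n' K]
  else projective M.

Lemma pdle_iso n M N (f : {linear M -> N}) :
  injective f -> surj f -> pdle n M -> pdle n N.
Proof.
case: n => [|n] fi fs /=; first exact: projective_iso fi fs.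
case=> K [P [i [g [[ii sg ex] pP pK]]]]; exists K, P, i, (f \o g); split=> //.
split=> // [y|x /=].
  by have [x <-] := fs y; have [z <-] := sg x; exists z.
rewrite -ex; split=> [e|->]; last exact: linear0.
by apply: fi; rewrite e linear0.
Qed.

Lemma pdleS n M : pdle n M -> pdle n.+1 M.
Proof.
elim: n M => [|n IH] M.
  move=> pM; exists (ker_mod (idfun : {linear M -> M})), M, val, idfun.
  split=> //; first by apply: ses_ker => y; exists y.
  by apply: projective0 => x; apply: val_inj; rewrite [LHS](ker_valP x).
by case=> K [P [i [g [? ? pK]]]]; exists K, P, i, g; split=> //; apply: IH.
Qed.

Lemma pdle_leq m n M : (m <= n)%N -> pdle m M -> pdle n M.
Proof.
move=> /subnK <-; elim: (n - m)%N => // l IH pM.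
by rewrite addSn; apply/pdleS/IH.
Qed.

(** The covers of A and C add up to a cover of B, and the kernel of the latter
    is again an extension of the two syzygies. *)
Lemma horseshoe n A B C (i : {linear A -> B}) (g : {linear B -> C}) :
  ses i g -> pdle n A -> pdle n C -> pdle n B.
Proof.
elim: n A B C i g => [|n IH] A B C i g ex; have [inji sg exB] := ex.
  move=> /= pA pC; have [s sE] := pC _ _ g idfun sg.
  apply: (@projective_iso (A * C)%type B (pair_sum i s)); last exact: projective_prod.
    suff H x : pair_sum i s x = 0 -> x = 0.
      by move=> x y e; apply/subr0_eq/H; rewrite linearB e subrr.
    move=> /= e; have gi : g (i x.1) = 0 by apply/exB; exists x.1.
    have x2 : x.2 = 0.
      by move/(congr1 g): e; rewrite linearD gi add0r sE linear0.
    move: e; rewrite x2 linear0 addr0 -(linear0 i) => /inji x1.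
    by apply: injective_projections.
  move=> b; have /exB[a aE] : g (b - s (g b)) = 0.
    by rewrite linearB sE subrr.
  by exists (a, g b); rewrite /= aE subrK.
case=> KA [PA [iA [gA [exA pPA pKA]]]]; case=> KC [PC [iC [gC [exC pPC pKC]]]].
have [inA sA eA] := exA; have [inC sC eC] := exC.
have [h hE] := pPC _ _ g gC sg.
have gi a : g (i a) = 0 by apply/exB; exists a.
pose G := pair_sum (i \o gA) h.
have sG : surj G.
  move=> b; have [c cE] := sC (g b).
  have /exB[a aE] : g (b - h c) = 0 by rewrite linearB hE cE subrr.
  by have [a' a'E] := sA a; exists (a', c); rewrite /= a'E aE subrK.
exists (ker_mod G), (PA * PC)%type, val, G; split; first exact: ses_ker.
  exact: projective_prod.
have [|j jE] := @factor_inj _ _ _ val G KA (in_left PA PC \o iA) (ses_ker sG).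
  move=> x; rewrite /= linear0 addr0 (_ : gA _ = 0) ?linear0 //.
  by apply/eA; exists x.
have [|q qE] := @factor_inj _ _ _ iC gC (ker_mod G) (snd \o val) exC.
  move=> x /=; rewrite -hE; have /= := congr1 g (ker_valP x).
  by rewrite linearD gi add0r linear0.
apply: (IH _ _ _ j q) => //; split.
- by move=> x y e; apply: inA; have := congr1 fst (jE x); rewrite e (congr1 fst (jE y)).
- move=> c; have /exB[a aE] : g (- h (iC c)) = 0.
    by rewrite linearN hE (_ : gC _ = 0) ?oppr0 //; apply/eC; exists c.
  have [a' a'E] := sA a.
  have kx : (a', iC c) \in in_ker G by apply/eqP; rewrite /= a'E aE addNr.
  by exists (KerMod kx); apply: inC; rewrite qE.
- move=> x; split=> [qx|[y <-]]; last first.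
    by apply: inC; rewrite qE linear0 [LHS](congr1 snd (jE y)).
  have x2 : (val x).2 = 0 by rewrite -[LHS](qE x) qx linear0.
  have := ker_valP x; rewrite /= x2 linear0 addr0 -(linear0 i) => /inji /eA[y yE].
  exists y; apply: val_inj; rewrite jE /=.
  by apply: injective_projections; rewrite //= x2.
Qed.

(** The syzygy of C for the composite cover P -> B -> C is an extension of A by
    the syzygy of B. *)
Lemma pdle_coker n A B C (i : {linear A -> B}) (g : {linear B -> C}) :
  ses i g -> pdle n A -> pdle n.+1 B -> pdle n.+1 C.
Proof.
move=> ex pA [K [P [j [p [exP pP pK]]]]].
have [inji sg exB] := ex; have [injj sp eP] := exP.
have [G GE] : exists G : {linear P -> C}, forall x, G x = g (p x).
  by exists (g \o p).
have sG : surj G.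
  by move=> c; have [b <-] := sg c; have [x <-] := sp b; exists x.
exists (ker_mod G), P, val, G; split=> //; first exact: ses_ker.
have [|a aE] := @factor_inj _ _ _ val G K j (ses_ker sG).
  by move=> x; rewrite GE (_ : p _ = 0) ?linear0 //; apply/eP; exists x.
have [|q qE] := @factor_inj _ _ _ i g (ker_mod G) (p \o val) ex.
  by move=> x; rewrite -GE ker_valP.
apply: (@horseshoe n _ _ _ a q _ pK pA); split.
- by move=> x y e; apply: injj; rewrite -!aE e.
- move=> y; have [x xE] := sp (i y).
  have kx : x \in in_ker G by apply/eqP; rewrite GE xE; apply/exB; exists y.
  by exists (KerMod kx); apply: inji; rewrite qE.
- move=> x; split=> [qx|[y <-]].
    have := qE x; rewrite qx linear0 => /esym /eP[y yE].
    by exists y; apply: val_inj; rewrite aE.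
  apply: inji; rewrite linear0; apply: etrans (qE _) _.
  by rewrite /= [\val _]aE; apply/eP; exists y.
Qed.

Lemma pdle_of_resolution n M : has_resolution_le M n -> pdle n M.
Proof.
case=> P; elim: n M P => [|n IH] M P P0.
  apply: (@projective_iso _ _ (pr_aug P)); last exact: pr_projective.
    move=> x y e; apply/subr0_eq.
    have /pr_exact0[z <-] : pr_aug P (x - y) = 0 by rewrite linearB e subrr.
    by rewrite (P0 1%N isT z) linear0.
  exact: pr_aug_surj.
have exP := ses_ker (@pr_aug_surj _ _ P).
exists (ker_mod (pr_aug P)), (P 0%N), val, (pr_aug P); split=> //.
  exact: pr_projective.
have [|a aE] := factor_inj (h := pr_diff P 0) exP.
  by move=> x; apply/pr_exact0; exists x.
have as_ : surj a.
  move=> y; have /pr_exact0[x xE] := ker_valP y.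
  by exists x; apply: val_inj; rewrite aE.
have a0 x : a x = 0 <-> exists y, pr_diff P 1 y = x.
  rewrite -pr_exactS -aE; split=> [->|e]; first exact: linear0.
  by apply: val_inj; rewrite e linear0.
pose Q := @ProjResolution R (ker_mod (pr_aug P)) (fun i => P i.+1)
  (fun i => pr_diff P i.+1) a (fun i => @pr_projective _ _ P i.+1) as_ a0
  (fun i => @pr_exactS _ _ P i.+1).
by apply: (IH _ Q) => i ni x; apply: P0.
Qed.

(** A resolution of the syzygy K is spliced with 0 -> K -> P -> M -> 0. *)
Lemma resolution_of_pdle n M : pdle n M -> has_resolution_le M n.
Proof.
elim: n M => [|n IH] M.
  move=> pM.
  pose Z : lmodType R := ker_mod (idfun : {linear M -> M}).
  have Z0 (x : Z) : x = 0 by apply: val_inj; rewrite [LHS](ker_valP x).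
  pose md i : lmodType R := if i is _.+1 then Z else M.
  pose df i : {linear md i.+1 -> md i} := \0.
  have md_proj i : projective (md i) by case: i => //= _; apply: projective0.
  have ex0 (x : M) : idfun x = 0 <-> exists y, df 0%N y = x.
    by split=> [/= ->|[y <-]] //; exists 0.
  have exS i (x : md i.+1) : df i x = 0 <-> exists y, df i.+1 y = x.
    by split=> // _; exists 0; rewrite [RHS]Z0.
  have ids : surj (idfun : {linear M -> M}) by move=> y; exists y.
  exists (ProjResolution md_proj ids ex0 exS).
  by case=> // i _ x; apply: Z0.
case=> K [P [i [g [[inji sg exP] pP /IH[Q Q0]]]]].
pose md l : lmodType R := if l is l'.+1 then Q l' else P.
pose df l : {linear md l.+1 -> md l} :=
  match l with 0 => i \o pr_aug Q | l'.+1 => pr_diff Q l' end.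
have md_proj l : projective (md l) by case: l => //= l; apply: pr_projective.
have ex0 (x : P) : g x = 0 <-> exists y, df 0%N y = x.
  rewrite exP; split=> [[y <-]|[y <-]]; last by exists (pr_aug Q y).
  by have [z <-] := pr_aug_surj Q y; exists z.
have exS l (x : md l.+1) : df l x = 0 <-> exists y, df l.+1 y = x.
  case: l x => [|l] x /=; last exact: pr_exactS.
  rewrite -pr_exact0; split=> [|->]; last exact: linear0.
  by rewrite -(linear0 i) => /inji.
exists (ProjResolution md_proj sg ex0 exS).
by case=> // l ln x; apply: Q0.
Qed.

End Modules.

(** * Regular sequences on projective modules *)

Section Span.
Variable R : nzRingType.
Implicit Types (K L M N P : lmodType R) (xs : seq R).

(** The submodule (xs)M, unfolded one generator at a time so as to follow the
    recursion of the Koszul cochains below. *)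
Fixpoint span M xs (a : M) : Prop :=
  if xs is x :: xs' then exists b, span xs' (a - x *: b) else a = 0.

Lemma span0 M xs : span xs (0 : M).
Proof. by elim: xs => //= x xs IH; exists 0; rewrite scaler0 subr0. Qed.

Lemma spanD M xs (a b : M) : span xs a -> span xs b -> span xs (a + b).
Proof.
elim: xs a b => /= [a b -> ->|x xs IH a b [a' sa] [b' sb]]; first exact: addr0.
by exists (a' + b'); rewrite scalerDr opprD addrACA; apply: IH.
Qed.

Lemma span_linear M N (f : {linear M -> N}) xs a : span xs a -> span xs (f a).
Proof.
elim: xs a => /= [a ->|x xs IH a [b /IH]]; first exact: linear0.
by rewrite linearB linearZ; exists (f b).
Qed.

Lemma span_sum M (I : Type) (r : seq I) (F : I -> M) xs :
  (forall i, span xs (F i)) -> span xs (\sum_(i <- r) F i).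
Proof. by move=> sF; apply: big_ind => //; [exact: span0 | exact: spanD]. Qed.

Definition regular_on M x xs := forall a : M, span xs (x *: a) -> span xs a.

End Span.

Section Free.
Variable R : nzRingType.
Implicit Types (K L M N P : lmodType R) (xs : seq R).

Section Cover.
Variable M : lmodType R.

Local Notation F := {freeg M / R}.

Fact freegZU (c k : R) (m : M) : c *: << k *g m >> = << c * k *g m >> :> F.
Proof. by apply/eqP/freeg_eqP => z; rewrite coeffZ !coeffU mulrA. Qed.

(** The map from the free module on the elements of M to M. *)
Fact cover_lin : linear (fglift (@id M) : F -> M).
Proof.
move=> c D E; rewrite /= -[_ + E]/(c *: D + E).
have add := lift_is_additive (@id M).
have addD (u v : F) : fglift (@id M) (u + v) = fglift (@id M) u + fglift (@id M) v.
  have addN w : fglift (@id M) (- w : F) = - fglift (@id M) w.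
    by rewrite -[- w]add0r add -[X in fglift _ X](subrr (0 : F)) add subrr sub0r.
  by rewrite -{1}[v]opprK add addN opprK.
rewrite addD; congr (_ + _).
rewrite -[D]freeg_sumE scaler_sumr.
have add0 : fglift (@id M) (0 : F) = 0 by rewrite -[X in fglift _ X](subrr (0 : F)) add subrr.
rewrite !(big_morph _ addD add0) scaler_sumr; apply: eq_bigr => z _.
by rewrite freegZU !liftU scalerA.
Qed.

Definition cover : {linear F -> M} := mk_linear cover_lin.

Lemma cover_surj : surj cover.
Proof. by move=> m; exists << 1 *g m >>; rewrite /= liftU scale1r. Qed.

Fact coord_lin m : linear (coeff m : F -> R^o).
Proof. by move=> c D E; rewrite /= coeffD coeffZ. Qed.

Fact unit_lin m : linear (fun c : R^o => << (c : R) *g m >> : F).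
Proof.
by move=> c D E; apply/eqP/freeg_eqP => z; rewrite coeffD coeffZ !coeffU mulrDl -mulrA.
Qed.

(** Regularity can be tested on each coordinate, and an element of a free module
    is a finite sum of its coordinates. *)
Lemma regular_free x xs : regular_on R^o x xs -> regular_on F x xs.
Proof.
move=> reg a sa; rewrite -[a]freeg_sumE; apply: span_sum => m.
apply: (span_linear (mk_linear (unit_lin m))); apply: reg.
have := span_linear (mk_linear (coord_lin m)) sa.
by rewrite linearZ.
Qed.

End Cover.

(** A projective module is a direct summand of its free cover. *)
Lemma regular_projective P x xs :
  projective P -> regular_on R^o x xs -> regular_on P x xs.
Proof.
move=> pP /(@regular_free P x xs) reg a sa.
have [s sE] := pP _ _ (cover P) idfun (@cover_surj P).
rewrite -[a]sE; apply/span_linear/reg; rewrite -linearZ.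
exact: span_linear.
Qed.
End Free.

(** * Koszul cochains and depth *)

Section Koszul.
Variable R : comNzRingType.
Implicit Types (K L M N P : lmodType R) (xs : seq R).

(** Adjoining x to the sequence takes the cone of multiplication by x, whence the
    pairs.  All degrees live in one module, and [kdeg] singles out the
    homogeneous cochains. *)
Fixpoint koszul xs M : lmodType R :=
  if xs is _ :: xs' then (koszul xs' M * koszul xs' M)%type else M.

Fixpoint koszul_diff xs M : koszul xs M -> koszul xs M :=
  if xs is x :: xs' then fun a => (koszul_diff a.1, x *: a.1 - koszul_diff a.2)
  else fun=> 0.

Fact koszul_diff_linear xs M : linear (@koszul_diff xs M).
Proof.
elim: xs => [c a b|x xs IH c a b] /=; first by rewrite scaler0 addr0.
apply: injective_projections; rewrite /= !IH //.
by rewrite scalerDr !scalerA mulrC scalerBr scalerA opprD addrACA.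
Qed.
(** Locked, so that simplification does not replace the linear map by the
    recursive function under it. *)
Definition kdiff {xs M} : {linear koszul xs M -> koszul xs M} :=
  locked (mk_linear (@koszul_diff_linear xs M)).

Lemma kdiff_cons x xs M (a : koszul (x :: xs) M) :
  kdiff a = (kdiff (xs := xs) a.1, x *: a.1 - kdiff (xs := xs) a.2).
Proof. by rewrite /kdiff -!lock. Qed.

Lemma kdiff_nil M (a : koszul [::] M) : kdiff a = 0.
Proof. by rewrite /kdiff -lock. Qed.

Lemma kdiff_kdiff xs M (a : koszul xs M) : kdiff (kdiff a) = 0.
Proof.
elim: xs a => [a|x xs IH a]; first by rewrite kdiff_nil.
by rewrite !kdiff_cons IH /= linearB linearZ IH subr0 subrr.
Qed.

(** [kdeg i.+1] is cohomological degree i, and [kdeg 0] contains only zero.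
    The shift spares a separate treatment of degree 0, where nothing bounds. *)
Fixpoint kdeg xs M i : koszul xs M -> Prop :=
  if xs is _ :: xs' then fun a => kdeg i a.1 /\ kdeg i.-1 a.2
  else fun a => i = 1%N \/ a = 0.

Lemma kdeg0 xs M (a : koszul xs M) : kdeg 0 a <-> a = 0.
Proof.
elim: xs a => /= [a|x xs IH a]; first by split=> [[]|]; [| | right].
rewrite !IH; split=> [[a1 a2]|->//]; exact: injective_projections.
Qed.

Lemma kdeg_zero xs M i : kdeg i (0 : koszul xs M).
Proof. by elim: xs i => [|x xs IH] i /=; [right | split]. Qed.

Lemma kdegD xs M i (a b : koszul xs M) : kdeg i a -> kdeg i b -> kdeg i (a + b).
Proof.
elim: xs i a b => /= [i a b|x xs IH i a b [? ?] [? ?]]; last by split; apply: IH.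
by case=> [->|->]; [left | rewrite add0r].
Qed.

Lemma kdegZ xs M i c (a : koszul xs M) : kdeg i a -> kdeg i (c *: a).
Proof.
elim: xs i a => /= [i a|x xs IH i a [? ?]]; last by split; apply: IH.
by case=> [->|->]; [left | rewrite scaler0; right].
Qed.

Lemma kdegN xs M i (a : koszul xs M) : kdeg i a -> kdeg i (- a).
Proof. by rewrite -scaleN1r; apply: kdegZ. Qed.

Lemma kdeg_kdiff xs M i (a : koszul xs M) : kdeg i a -> kdeg i.+1 (kdiff a).
Proof.
elim: xs i a => [|x xs IH] i a; first by right; rewrite kdiff_nil.
rewrite kdiff_cons /= => -[a1 a2]; split; first exact: IH.
case: i a1 a2 => [|i] a1 a2 /=.
  move/kdeg0: a1 => ->; move/kdeg0: a2 => ->.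
  by rewrite scaler0 linear0 subr0; apply: kdeg_zero.
by apply: kdegD; [apply: kdegZ | apply/kdegN/IH].
Qed.

Lemma kdeg_overflow xs M i (a : koszul xs M) : ((size xs).+1 < i)%N -> kdeg i a -> a = 0.
Proof.
elim: xs i a => /= [|x xs IH] i a; first by move=> + [e|//]; rewrite e.
case: i => // i lt [a1 a2]; apply: injective_projections.
  by apply: IH a1; apply: ltnW.
exact: IH a2.
Qed.

Fixpoint koszul_map xs M N (f : {linear M -> N}) : koszul xs M -> koszul xs N :=
  if xs is _ :: xs' then fun a => (koszul_map f a.1, koszul_map f a.2) else f.

Fact koszul_map_linear xs M N (f : {linear M -> N}) : linear (koszul_map (xs := xs) f).
Proof.
elim: xs => [|x xs IH] c a b /=; first exact: linearP.
by apply: injective_projections; rewrite /= IH.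
Qed.
Definition kmap xs M N (f : {linear M -> N}) : {linear koszul xs M -> koszul xs N} :=
  locked (mk_linear (koszul_map_linear (xs := xs) f)).

Lemma kmap_nil M N (f : {linear M -> N}) (a : koszul [::] M) : kmap [::] f a = f a.
Proof. by rewrite /kmap -lock. Qed.

Lemma kmap_cons x xs M N (f : {linear M -> N}) (a : koszul (x :: xs) M) :
  kmap (x :: xs) f a = (kmap xs f a.1, kmap xs f a.2).
Proof. by rewrite /kmap -!lock. Qed.

Lemma kmap_kdiff xs M N (f : {linear M -> N}) (a : koszul xs M) :
  kmap xs f (kdiff a) = kdiff (kmap xs f a).
Proof.
elim: xs a => [|x xs IH] a; first by rewrite kdiff_nil linear0 kdiff_nil.
by rewrite kmap_cons !kdiff_cons kmap_cons /= linearB linearZ !IH.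
Qed.

Lemma kmap_kdeg xs M N (f : {linear M -> N}) i (a : koszul xs M) :
  kdeg i a -> kdeg i (kmap xs f a).
Proof.
elim: xs i a => [i a|x xs IH i a []]; last first.
  by rewrite kmap_cons; split; apply: IH.
by rewrite kmap_nil => -[|->]; [left | right; apply: linear0].
Qed.

Lemma kmap_inj xs M N (f : {linear M -> N}) :
  injective f -> injective (kmap xs f).
Proof.
move=> fi; elim: xs => [|x xs IH] a b; first by rewrite !kmap_nil => /fi.
rewrite !kmap_cons => -[/IH e1 /IH e2]; exact: injective_projections.
Qed.

Lemma kmap_ker xs M N L (f : {linear M -> N}) (g : {linear N -> L}) i
    (a : koszul xs N) :
  ses f g -> kdeg i a -> kmap xs g a = 0 -> exists2 b, kdeg i b & kmap xs f b = a.
Proof.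
case=> fi _ ex; elim: xs i a => [|x xs IH] i a.
  rewrite kmap_nil => da /ex[b fb].
  exists b; last by rewrite kmap_nil.
  by case: da => [->|a0]; [left | right; apply: fi; rewrite fb a0 linear0].
rewrite kmap_cons => -[d1 d2] e.
have [b1 db1 e1] := IH _ _ d1 (congr1 fst e).
have [b2 db2 e2] := IH _ _ d2 (congr1 snd e).
exists (b1, b2) => //; rewrite kmap_cons e1 e2.
exact: injective_projections.
Qed.

Lemma kmap_surj xs M N (g : {linear M -> N}) i (a : koszul xs N) :
  surj g -> kdeg i a -> exists2 b, kdeg i b & kmap xs g b = a.
Proof.
move=> sg; elim: xs i a => [|x xs IH] i a.
  case=> [->|->]; last by exists 0; [right | exact: linear0].
  by have [b bE] := sg a; exists b; [left | rewrite kmap_nil].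
case=> /IH[b1 ? e1] /IH[b2 ? e2]; exists (b1, b2) => //.
by rewrite kmap_cons e1 e2; apply: injective_projections.
Qed.

(** The vanishing of the cohomology H^i (xs; M) for i < g. *)
Definition acyclic_below xs g M : Prop := forall i, (i < g)%N ->
  forall a : koszul xs M, kdeg i.+1 a -> kdiff a = 0 -> exists2 b, kdeg i b & kdiff b = a.

Fixpoint koszul_top xs M : M -> koszul xs M :=
  if xs is _ :: xs' then fun m => (0, koszul_top xs' m) else id.

Fact koszul_top_linear xs M : linear (@koszul_top xs M).
Proof.
elim: xs => [|x xs IH] c a b //=; apply: injective_projections => /=.
  by rewrite scaler0 addr0.
exact: IH.
Qed.
Definition ktop xs M : {linear M -> koszul xs M} := locked (mk_linear (@koszul_top_linear xs M)).

Lemma ktop_nil M (m : M) : ktop [::] M m = m.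
Proof. by rewrite /ktop -lock. Qed.

Lemma ktop_cons x xs M (m : M) : ktop (x :: xs) M m = (0, ktop xs M m).
Proof. by rewrite /ktop -!lock. Qed.

Lemma kdeg_top xs M (a : koszul xs M) : kdeg (size xs).+1 a -> exists m, a = ktop xs M m.
Proof.
elim: xs a => [|x xs IH] a /=; first by exists a; rewrite ktop_nil.
case=> /kdeg_overflow e1 /IH[m mE]; exists m; rewrite ktop_cons.
by apply: injective_projections; rewrite //= e1.
Qed.

Lemma kdeg_ktop xs M (m : M) : kdeg (size xs).+1 (ktop xs M m).
Proof.
elim: xs => [|x xs IH]; first by left.
by rewrite ktop_cons; split=> //=; apply: kdeg_zero.
Qed.

(** The top cohomology is M/(xs)M. *)
Lemma ktop_boundary xs M (m : M) :
  (exists2 b, kdeg (size xs) b & kdiff b = ktop xs M m) <-> span xs m.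
Proof.
elim: xs m => [|x xs IH] m.
  rewrite ktop_nil /=; split=> [[b _ <-]|->]; first exact: kdiff_nil.
  by exists 0; [right | rewrite kdiff_nil].
split=> [[b [/kdeg_top[m1 e1] d2]]|[c /IH[b db e]]].
  rewrite kdiff_cons e1 ktop_cons => /(congr1 snd) /= e; exists m1; apply/IH.
  exists (- b.2); first exact: kdegN.
  by rewrite linearN linearB linearZ -[ktop xs M m]e addrAC subrr add0r.
exists (ktop xs M c, - b); first by split; [apply: kdeg_ktop | apply: kdegN].
rewrite kdiff_cons ktop_cons linearN e linearB linearZ opprK addrC subrK; congr (_, _).
by apply: (@kdeg_overflow xs M (size xs).+2) => //; apply/kdeg_kdiff/kdeg_ktop.
Qed.

Fixpoint regular_seq M xs : Prop :=
  if xs is x :: xs' then regular_on M x xs' /\ regular_seq M xs' else True.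

(** In a cocycle (a, b) for x :: xs, the first component is a cocycle for xs, and x a
    bounds.  Below the top degree a bounds by induction.  In the top degree it
    is a class of M/(xs)M killed by x, and regularity applies. *)
Lemma acyclic_regular xs M : regular_seq M xs -> acyclic_below xs (size xs) M.
Proof.
elim: xs => [|x xs IH] //= [rx /IH{}IH] i ilt [a b] [/= da db].
rewrite kdiff_cons => -[da0 /eqP]; rewrite subr_eq0 => /eqP xa.
have [a' da' ea] : exists2 a', kdeg i a' & kdiff a' = a.
  move: ilt; rewrite ltnS leq_eqVlt => /orP[/eqP ei|lt]; last exact: IH.
  move: da db; rewrite ei => /kdeg_top[m mE] db.
  rewrite mE; apply/ktop_boundary/rx/ktop_boundary; exists b => //.
  by rewrite linearZ -mE.
have [b' db' eb] : exists2 b', kdeg i.-1 b' & kdiff b' = b - x *: a'.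
  case: i ilt db da da' => [|i] ilt db da da'.
    exists 0; first exact: kdeg_zero.
    by move/kdeg0: db => ->; move/kdeg0: da' => ->; rewrite scaler0 subr0 linear0.
  apply: IH => //; first by apply: kdegD => //; apply/kdegN/kdegZ.
  by rewrite linearB linearZ ea [kdiff b](esym xa) subrr.
exists (a', - b'); first by split=> //; apply: kdegN.
by rewrite kdiff_cons ea /= linearN eb opprK addrC subrK.
Qed.

(** Since H^i (xs; P) = 0, the connecting map H^i (M) -> H^(i+1) (K) is
    injective; so each syzygy costs exactly one degree of vanishing. *)
Lemma acyclic_pdle xs n M :
  (forall P, projective P -> regular_seq P xs) ->
  pdle n M -> acyclic_below xs (size xs - n) M.
Proof.
move=> reg; elim: n M => [|n IH] M.
  by rewrite subn0 => /reg; apply: acyclic_regular.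
case=> K [P [f [g [ex /reg/acyclic_regular aP /IH aK]]]] i ilt a da d0.
have [fi sg _] := ex.
have [l dl el] := kmap_surj sg da.
have [|b db eb] := kmap_ker ex (kdeg_kdiff dl); first by rewrite kmap_kdiff el.
have ltK : (i.+1 < size xs - n)%N by move: ilt; rewrite subnS; case: (size xs - n)%N.
have [|c dc ec] := aK _ ltK b db.
  by apply: (kmap_inj fi); rewrite kmap_kdiff eb kdiff_kdiff linear0.
have [||e de ee] := aP i (leq_trans (ltnW ltK) (leq_subr _ _)) (l - kmap xs f c).
- by apply: kdegD => //; apply/kdegN/kmap_kdeg.
- by rewrite linearB -kmap_kdiff ec eb subrr.
exists (kmap xs g e); first exact: kmap_kdeg.
have gf ys (u : koszul ys K) : kmap ys g (kmap ys f u) = 0.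
  elim: ys u => [|y ys IHys] u; last by rewrite !kmap_cons !IHys.
  by rewrite !kmap_nil; have [_ _ h] := ex; apply/h; exists u.
by rewrite -kmap_kdiff ee linearB el gf subr0.
Qed.

(** An element killed by xs is a class of H^0 (xs; M), and it is nonzero because
    nothing bounds in degree 0. *)
Lemma socle_pdle xs n M (m : M) :
  (forall P, projective P -> regular_seq P xs) ->
  (forall x, x \in xs -> x *: m = 0) -> m <> 0 ->
  pdle n M -> (size xs <= n)%N.
Proof.
move=> reg xm m0 /(acyclic_pdle reg) ac; rewrite leqNgt; apply/negP => nlt.
(* m in degree 0 *)
pose fix bot ys : koszul ys M :=
  if ys is _ :: ys' return koszul ys M then (bot ys', 0) else m.
have botd ys : {subset ys <= xs} -> kdeg 1 (bot ys) /\ kdiff (bot ys) = 0.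
  elim: ys => [|y ys IH] sub; first by split; [left | rewrite kdiff_nil].
  have [|db d0] := IH; first by move=> z zy; apply: sub; rewrite in_cons zy orbT.
  split; first by split=> //; apply/kdeg0.
  rewrite kdiff_cons d0 linear0 subr0; congr (_, _); move: (sub y (mem_head _ _)) => /xm ym.
  by elim: ys {IH sub db d0} => //= z ys IH; apply: injective_projections; rewrite //= scaler0.
have [//|dx d0] := botd xs.
have [|b /kdeg0 ->] := ac 0%N _ _ dx d0; first by rewrite subn_gt0.
rewrite linear0 => e; apply: m0.
elim: xs {reg xm ac nlt botd dx d0 b} e => [-> //|x xs IH] /= /(congr1 fst).
exact: IH.
Qed.

End Koszul.

(** * Quotients by monomial ideals *)

Section Presentation.
Variable R : comNzRingType.
Implicit Types (I : {pred R}) (M A B C : lmodType R).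

(** M is a copy of R/I.  Working with presentations lets the same statements
    apply to whichever model of the quotient is at hand. *)
Definition presents I M : Prop :=
  exists2 p : {linear R^o -> M}, surj p & forall a, p a = 0 <-> a \in I.

Lemma presents_pdle I M N n : presents I M -> presents I N -> pdle n M -> pdle n N.
Proof.
move=> [p sp kp] [q sq kq].
have [|f fE] := factor_surj (h := q) sp; first by move=> a /kp/kq.
apply: (@pdle_iso _ _ _ _ f) => [x y|y]; last first.
  by have [a <-] := sq y; exists (p a).
have [a <-] := sp x; have [b <-] := sp y; rewrite !fE => e.
apply/subr0_eq; rewrite -linearB; apply/kp/kq.
by rewrite linearB e subrr.
Qed.

Fact mulr_right_lin (x : R) : linear (fun a : R^o => a * x : R^o).
Proof. by move=> a b c; rewrite mulrDl /GRing.scale /= mulrA. Qed.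

(** The sequence 0 -> R/(J : x) -> R/J -> R/(J + x) -> 0, with I = J : x and
    L = J + x. *)
Lemma presents_ses I J L A B C x :
  presents I A -> presents J B -> presents L C ->
  (forall a, (a \in I) = (a * x \in J)) ->
  (forall a, a \in L <-> exists r, a - r * x \in J) ->
  exists (i : {linear A -> B}) (g : {linear B -> C}), ses i g.
Proof.
move=> [p sp kp] [q sq kq] [r sr kr] IJ LJ.
pose mx : {linear R^o -> R^o} := mk_linear (@mulr_right_lin x).
have [|i iE] := factor_surj (h := q \o mx) sp.
  by move=> a /kp; rewrite IJ => /kq.
have [|g gE] := factor_surj (h := r) sq.
  by move=> a /kq aJ; apply/kr/LJ; exists 0; rewrite mul0r subr0.
exists i, g; split.
- move=> u v; have [a <-] := sp u; have [b <-] := sp v; rewrite !iE => e.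
  apply/subr0_eq; rewrite -linearB; apply/kp; rewrite IJ; apply/kq.
  by rewrite mulrBl linearB [q _]e subrr.
- by move=> z; have [a <-] := sr z; exists (q a).
- move=> z; have [a <-] := sq z; rewrite gE; split=> [/kr/LJ[c]|[y]].
    move/kq; rewrite linearB => /subr0_eq e; exists (p c); rewrite iE.
    by rewrite e.
  have [c <-] := sp y; rewrite iE => e; apply/kr/LJ; exists c; apply/kq.
  by rewrite linearB [X in _ - X]e subrr.
Qed.

Fact quot_pi_lin (I : idealr R) :
  linear (fun a : R^o => \pi_({ideal_quot I})%qT (a : R) : {ideal_quot I}).
Proof. by move=> a b c; rewrite rmorphD rmorphM. Qed.

Lemma presents_quot (I : idealr R) : presents I {ideal_quot I}.
Proof.
exists (mk_linear (@quot_pi_lin I)) => [y|a] /=; first by exists (repr y); rewrite reprK.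
rewrite -[0](rmorph0 (\pi_({ideal_quot I})%qT)).
have := Quotient.idealrBE I a 0; rewrite subr0 => ->.
by split=> /eqP.
Qed.

End Presentation.

Section Monomial.
Variables (n : nat) (K : fieldType).
Local Notation S := {mpoly K[n]}.
Implicit Types (p q : S) (m : 'X_{1..n}).

(** A proper monomial ideal is determined by its monomials; colons and sums with
    a variable become operations on predicates. *)
Record upset := Upset {
  up_pred :> pred 'X_{1..n};
  up_closed : forall m m', up_pred m -> (m <= m')%MM -> up_pred m';
  up_proper : ~~ up_pred 0%MM }.
Implicit Type B : upset.

Definition monideal B : {pred S} := fun p => all B (msupp p).

Fact monideal_closed B : idealr_closed (monideal B).
Proof.
split; rewrite ?/monideal /in_mem /=.
- by rewrite msupp0.
- by rewrite msupp1 /= andbT up_proper.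
- move=> a p q /allP pB /allP qB; apply/allP => m /msuppD_le.
  rewrite mem_cat => /orP[/msuppM_le/allpairsP[[u v] /= [_ /pB Bv ->]]|/qB //].
  by apply: up_closed Bv (lem_addl _ _).
Qed.
HB.instance Definition _ B :=
  isIdealr.Build S (monideal B) (monideal_closed B).

Lemma monidealP B p : reflect {in msupp p, forall m, B m} (p \in monideal B).
Proof. exact: allP. Qed.

(** r is the part of p divisible by the variable, divided by it. *)
Lemma split_var i p : exists r, forall m, m \in msupp (p - r * 'X_i) ->
  m \in msupp p /\ m i = 0%N.
Proof.
pose r := \sum_(m <- msupp p | (0 < m i)%N) p@_m *: ('X_[(m - U_(i))%MM] : S).
exists r.
have -> : p - r * 'X_i = \sum_(m <- msupp p | m i == 0%N) p@_m *: 'X_[m].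
  rewrite {1}[p]mpolyE (bigID (fun m : 'X_{1..n} => m i == 0%N)) /= -addrA.
  rewrite [X in _ + X](_ : _ = 0) ?addr0 //; apply/eqP; rewrite subr_eq0 mulr_suml.
  under eq_bigl do rewrite -lt0n; apply/eqP/eq_bigr => m mi.
  rewrite -scalerAl -mpolyXD submK //; apply/mnm_lepP => j; rewrite mnm1E.
  by case: eqP => // <-.
move=> m; rewrite mcoeff_msupp raddf_sum /= => nz; split; last first.
  apply/eqP; apply: contraNT nz => mi; rewrite big1 // => u /eqP ui.
  rewrite mcoeffZ mcoeffX; case: eqP => [e|_]; last by rewrite mulr0.
  by rewrite -e ui in mi.
rewrite mcoeff_msupp; apply: contraNneq nz => pm0; apply/eqP; rewrite big1 // => u ui.
by rewrite mcoeffZ mcoeffX; case: eqP => [->|_]; rewrite ?mulr0 // pm0 mul0r.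
Qed.

Lemma monideal_add (B B' : upset) i p :
  (forall m, B' m = B m || (0 < m i)%N) ->
  p \in monideal B' <-> exists r, p - r * 'X_i \in monideal B.
Proof.
move=> BB'; split=> [/monidealP pB|[r rB]].
  have [r rP] := split_var i p; exists r; apply/monidealP => m /rP[/pB].
  by rewrite BB' => + mi; rewrite mi orbF.
rewrite -[p](subrK (r * 'X_i)); apply: rpredD.
  by apply/monidealP => m /(monidealP _ _ rB) Bm; rewrite BB' Bm.
apply: idealMr; apply/monidealP => m; rewrite msuppX inE => /eqP ->.
by rewrite BB' mnm1E eqxx orbT.
Qed.

Lemma monideal_colon (B B' : upset) i p :
  (forall m, B' m = B (m + U_(i))%MM) ->
  (p \in monideal B') = (p * 'X_i \in monideal B).
Proof.
move=> BB'; rewrite !unfold_in /monideal [RHS](perm_all _ (msuppMX _ _)) [RHS]all_map.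
by apply: eq_all => m /=; rewrite BB' addmC.
Qed.

Definition quot_mod B : lmodType S := {ideal_quot (monideal B)}.

Lemma quot_modP B : presents (monideal B) (quot_mod B).
Proof. exact: presents_quot. Qed.

Lemma pdle_eq B B' l : B =1 B' -> pdle l (quot_mod B) -> pdle l (quot_mod B').
Proof.
move=> e; apply: presents_pdle (quot_modP B) _.
have [p sp kp] := quot_modP B'; exists p => // a; rewrite kp.
by rewrite !unfold_in /monideal (eq_all e).
Qed.

Lemma pdle_monideal0 B l : B =1 pred0 -> pdle l (quot_mod B).
Proof.
move=> B0; apply: (@pdle_leq _ 0) => //.
have pS : presents (monideal B) (S^o).
  exists idfun => [y|a]; first by exists y.
  rewrite unfold_in /monideal (eq_all B0) all_pred0 size_eq0 msupp_eq0.
  by split=> [/= /eqP|/eqP].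
apply: presents_pdle pS (quot_modP B) _ => M N g f sg.
have [x xE] := sg (f 1).
have hL : linear (fun a : S^o => (a : S) *: x) by move=> a b c; rewrite scalerDl scalerA.
by exists (mk_linear hL) => a /=; rewrite linearZ /= xE -linearZ /GRing.scale /= mulr1.
Qed.

Lemma pdle_colon (B Bc Ba : upset) i l :
  (forall m, Bc m = B (m + U_(i))%MM) ->
  (forall m, Ba m = B m || (0 < m i)%N) ->
  pdle l (quot_mod Bc) -> pdle l (quot_mod Ba) -> pdle l (quot_mod B).
Proof.
move=> Ec Ea.
have [||f [g ex]] :=
  @presents_ses _ _ _ _ _ _ _ 'X_i (quot_modP Bc) (quot_modP B) (quot_modP Ba).
- by move=> a; apply: monideal_colon.
- by move=> a; apply: monideal_add.
exact: horseshoe ex.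
Qed.

(** A variable that the ideal does not involve is a nonzerodivisor on the
    quotient, so the colon ideal is the ideal itself. *)
Lemma pdle_addvar (B Ba : upset) i l :
  (forall m, B (m + U_(i))%MM = B m) ->
  (forall m, Ba m = B m || (0 < m i)%N) ->
  pdle l (quot_mod B) -> pdle l.+1 (quot_mod Ba).
Proof.
move=> Ec Ea.
have [||f [g ex]] :=
  @presents_ses _ _ _ _ _ _ _ 'X_i (quot_modP B) (quot_modP B) (quot_modP Ba).
- by move=> a; apply: monideal_colon => m; rewrite Ec.
- by move=> a; apply: monideal_add.
by move=> pB; apply: pdle_coker ex pB (pdleS pB).
Qed.

Lemma span_vars (L : seq 'I_n) p :
  span [seq 'X_i | i <- L] (p : S^o) <->
  {in msupp p, forall m, has (fun i => 0 < m i)%N L}.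
Proof.
elim: L p => [|i L IH] p /=.
  split=> [->|p0]; first by move=> m; rewrite msupp0.
  apply/eqP; rewrite -msupp_eq0; case: msupp p0 => // m s /(_ m).
  by rewrite mem_head => /(_ isT).
split=> [[b /IH pb] m|pL].
  rewrite -[p](subrK ('X_i *: b : S^o)) => /msuppD_le; rewrite mem_cat => /orP[/pb->|].
    by rewrite orbT.
  rewrite -[_ *: _]/(('X_i : S) * (b : S)) => /msuppM_le/allpairsP[[u v] /= []].
  by rewrite msuppX inE => /eqP -> _ ->; rewrite mnmDE mnm1E eqxx.
have [r rP] := split_var i p; exists r; apply/IH => m.
by rewrite /GRing.scale /= mulrC => /rP[/pL/orP[|//]] + mi; rewrite mi.
Qed.

(** Multiplication by a further variable does not change which variables of L
    divide a monomial. *)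
Lemma regular_vars (P : lmodType S) (L : seq 'I_n) :
  uniq L -> projective P -> regular_seq P [seq 'X_i | i <- L].
Proof.
move=> + pP; elim: L => //= i L IH /andP[iL uL]; split; last exact: IH.
apply: regular_projective => // a /span_vars aL; apply/span_vars => m ma.
have := aL (m + U_(i))%MM; rewrite /GRing.scale /= mulrC (perm_mem (msuppMX _ _)) addmC.
rewrite mem_map ?ma; last exact: addmI.
move=> /(_ isT) /hasP[j jL]; rewrite addmC mnmDE mnm1E => mj; apply/hasP; exists j => //.
by move: mj; case: eqP => [ij|_]; rewrite ?addn0 // ij jL in iL *.
Qed.

End Monomial.

(** * Edge ideals: deleting the neighbours of a vertex *)

(** The arithmetic of one step of the induction: a + 1 vertices leave the graph
    while only a variables join the ideal. *)
Lemma trade_bound E z w a l : (a <= E)%N ->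
  (E.+1 * z + E * (w + a + 1) < l)%N -> (E.+1 * (z + a) + E * w < l)%N.
Proof.
move=> aE; apply: leq_ltn_trans.
by rewrite mulnDr !mulnDr muln1 mulSn (mulSn E a); lia.
Qed.

Section Graph.
Variables (n : nat) (K : fieldType) (e : rel 'I_n).
Hypotheses (e_sym : forall u v, e u v = e v u) (e_irr : irreflexive e).
Implicit Types (Z W D : {set 'I_n}) (m : 'X_{1..n}).

(** The monomials of (Z) + I(G[W]).  Starting from an edge ideal, colons by
    vertices and sums with vertices produce only ideals of this form. *)
Definition divisible Z W : pred 'X_{1..n} := fun m =>
  [exists z in Z, 0 < m z]%N ||
  [exists u in W, exists v in W, [&& e u v, 0 < m u & 0 < m v]%N].

Lemma divisibleP Z W m : reflect
  ((exists2 z, z \in Z & 0 < m z)%N \/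
   exists u v, [/\ u \in W, v \in W, e u v, 0 < m u & 0 < m v]%N) (divisible Z W m).
Proof.
apply: (iffP orP) => [] [].
- by case/exists_inP => z; left; exists z.
- by case/exists_inP => u uW /exists_inP[v vW /and3P[? ? ?]]; right; exists u, v.
- by case=> z zZ mz; left; apply/exists_inP; exists z.
- case=> u [v [uW vW euv mu mv]]; right; apply/exists_inP; exists u => //.
  by apply/exists_inP; exists v => //; apply/and3P.
Qed.

Fact divisible_closed Z W m m' : divisible Z W m -> (m <= m')%MM -> divisible Z W m'.
Proof.
move=> /divisibleP h /mnm_lepP le; have pos i : (0 < m i)%N -> (0 < m' i)%N.
  by move=> mi; apply: leq_trans mi (le i).
apply/divisibleP; case: h => [[z zZ /pos mz]|[u [v [? ? ? /pos ? /pos ?]]]].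
  by left; exists z.
by right; exists u, v.
Qed.

Fact divisible_proper Z W : ~~ divisible Z W 0%MM.
Proof. by apply/divisibleP => -[[z _]|[u [v [_ _ _]]]]; rewrite mnm0E. Qed.

Definition divisible_upset Z W := Upset (@divisible_closed Z W) (divisible_proper Z W).

Definition nbh W x := [set v in W | e x v].

(** An edge at x becomes its other end after the colon by x, which makes the
    remaining edges at the neighbours of x redundant. *)
Lemma divisible_colon Z W x m : x \in W -> x \notin Z ->
  divisible (Z :|: nbh W x) (W :\: nbh W x :\ x) m = divisible Z W (m + U_(x))%MM.
Proof.
move=> xW xZ; have mE i : (0 < (m + U_(x))%MM i)%N = (0 < m i)%N || (x == i).
  by rewrite mnmDE mnm1E addn_gt0 lt0b.
apply/divisibleP/divisibleP => [[[z]|[u [v []]]]|[[z zZ]|[u [v [uW vW euv]]]]].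
- rewrite inE => /orP[zZ mz|]; first by left; exists z; rewrite // mE mz.
  rewrite inE => /andP[zW exz] mz; right; exists x, z.
  by rewrite !mE mz eqxx orbT.
- rewrite !inE => /and3P[_ _ uW] /and3P[_ _ vW] euv mu mv; right; exists u, v.
  by rewrite !mE mu mv.
- rewrite mE => /orP[mz|/eqP xz]; last by rewrite xz zZ in xZ.
  by left; exists z; rewrite // inE zZ.
rewrite !mE.
case: (eqVneq x u) => [xu|xu]; last case: (eqVneq x v) => [xv|xv].
- have -> : x == v = false by apply: contraTF euv => /eqP <-; rewrite -xu e_irr.
  by rewrite orbF => _ mv; left; exists v; rewrite // !inE vW xu euv orbT.
- rewrite orbF => mu _; left; exists u => //.
  by rewrite !inE uW e_sym xv euv orbT.
rewrite !orbF => mu mv.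
have [eu|eu] := boolP (e x u); first by left; exists u; rewrite // !inE uW eu orbT.
have [ev|ev] := boolP (e x v); first by left; exists v; rewrite // !inE vW ev orbT.
by right; exists u, v; rewrite !inE (eq_sym u) (eq_sym v) xu xv uW vW /= (negPf eu) (negPf ev).
Qed.

Lemma divisible_add Z W x m : divisible (x |: Z) (W :\ x) m = divisible Z W m || (0 < m x)%N.
Proof.
apply/divisibleP/orP => [[[z]|[u [v []]]]|[/divisibleP[[z zZ mz]|[u [v [uW vW euv mu mv]]]]|mx]].
- by rewrite !inE => /orP[/eqP ->|zZ] mz; [right | left; apply/divisibleP; left; exists z].
- rewrite !inE => /andP[_ ?] /andP[_ ?] ? ? ?; left; apply/divisibleP; right.
  by exists u, v.
- by left; exists z; rewrite // !inE zZ orbT.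
- have [ux|ux] := eqVneq u x; first by left; exists u; rewrite // !inE ux eqxx.
  have [vx|vx] := eqVneq v x; first by left; exists v; rewrite // !inE vx eqxx.
  by right; exists u, v; rewrite !inE ux vx.
- by left; exists x; rewrite // !inE eqxx.
Qed.

Lemma divisible_isolated Z W w : nbh W w = set0 -> divisible Z (W :\ w) =1 divisible Z W.
Proof.
move=> iso m; have nw v : v \in W -> e w v = false.
  by move=> vW; have := in_set0 v; rewrite -iso inE vW.
apply/divisibleP/divisibleP => [] [h|[u [v]]]; try by left.
  by rewrite !inE => -[/andP[_ ?] /andP[_ ?] ? ? ?]; right; exists u, v.
case=> uW vW euv mu mv; right; exists u, v; rewrite !inE uW vW; split=> //; rewrite andbT.
  by apply: contraTneq euv => ->; rewrite nw.
by apply: contraTneq euv => ->; rewrite e_sym nw.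
Qed.

Notation Q Z W := (quot_mod K (divisible_upset Z W)).

Lemma pdle_vars Z W : (forall u v, u \in W -> v \in W -> ~~ e u v) ->
  pdle #|Z| (Q Z W).
Proof.
move=> indep; have [k] := ubnP #|Z|; elim: k Z => // k IH Z.
have [->|[z zZ] Zk] := set_0Vmem Z.
  move=> _; apply: pdle_monideal0 => m; apply/divisibleP => -[[z]|[u [v [uW vW]]]].
    by rewrite inE.
  by rewrite (negPf (indep _ _ uW vW)).
have zZ' : (#|Z :\ z| < k)%N by move: Zk; rewrite (cardsD1 z) zZ.
rewrite (cardsD1 z) zZ add1n; apply: (@pdle_addvar _ _ (divisible_upset (Z :\ z) W) _ z); last exact: IH.
  move=> m; apply/divisibleP/divisibleP => [] [[u uZ mu]|[u [v [uW vW]]]];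
    try by rewrite (negPf (indep _ _ uW vW)).
    left; exists u => //; move: uZ mu; rewrite !inE => /andP[uz _].
    by rewrite mnmDE mnm1E eq_sym (negPf uz) addn0.
  by left; exists u => //; rewrite mnmDE addn_gt0 mu.
move=> m /=; apply/divisibleP/orP =>
    [[[u uZ mu]|[u [v [uW vW]]]]|[/divisibleP[[u]|[u [v [uW vW]]]]|mz]];
    try by rewrite (negPf (indep _ _ uW vW)).
- have [uz|uz] := eqVneq u z; first by right; rewrite -uz.
  by left; apply/divisibleP; left; exists u; rewrite // !inE uz.
- by rewrite !inE => /andP[_ uZ] mu; left; exists u.
- by left; exists z.
Qed.

Variable Delta : nat.
Hypotheses (Delta_gt0 : (0 < Delta)%N)
  (e_deg : forall u, (#|[set v | e u v]| <= Delta)%N).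

Lemma nbh_card W x : (#|nbh W x| <= Delta)%N.
Proof.
apply: leq_trans (e_deg x); apply/subset_leq_card/subsetP => v.
by rewrite !inE => /andP[].
Qed.

(** By induction on W.  Every branch of the deletion process around a vertex w
    ends with a pair (Z, W) to which [trade_bound] applies. *)
Lemma pdle_graph Z W l : [disjoint Z & W] ->
  (Delta.*2 * #|Z| + Delta.*2.-1 * #|W| < Delta.*2 * l.+1)%N -> pdle l (Q Z W).
Proof.
have [k] := ubnP #|W|; elim: k Z W l => // k IHk Z W l ltk dZW bnd.
have [W0|[w wW]] := set_0Vmem W.
  apply: (@pdle_leq _ #|Z|); last by apply: pdle_vars => u v; rewrite W0 inE.
  move: bnd; rewrite W0 cards0 muln0 addn0 ltn_mul2l ltnS => /andP[_].
  by [].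
(* a vertices turn into variables while c remain in W *)
have trade a c : (a < Delta.*2)%N -> #|W| = (c + a + 1)%N ->
    (Delta.*2 * (#|Z| + a) + Delta.*2.-1 * c < Delta.*2 * l.+1)%N.
  move=> aD cW; move: bnd aD; rewrite cW -[Delta.*2]prednK ?double_gt0 //= => bnd aD.
  exact: trade_bound.
clear bnd.
(* D is the set of neighbours of w deleted so far; all branches of the process
   end in a smaller W *)
have inner D : D \subset nbh W w -> pdle l (Q (Z :|: D) (W :\: D)); last first.
  by have := inner set0 (sub0set _); rewrite setU0 setD0.
have [j] := ubnP #|nbh W w :\: D|; elim: j D => // j IHj D ltj sD.
have DW : D \subset W by apply: subset_trans sD _; apply/subsetP => v; rewrite inE => /andP[].
have dZD : [disjoint Z & D] by apply: disjointWr dZW.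
have cD : (#|D| <= Delta)%N := leq_trans (subset_leq_card sD) (nbh_card W w).
have cZD : #|Z :|: D| = (#|Z| + #|D|)%N.
  by rewrite cardsU (disjoint_setI0 dZD) cards0 subn0.
have cWD : #|W :\: D| = (#|W| - #|D|)%N by rewrite cardsD (setIidPr DW).
have cDW := subset_leq_card DW.
have [xN|[x]] := set_0Vmem (nbh W w :\: D).
  have wD : w \notin D.
    by apply: contraFN (e_irr w) => /(subsetP sD); rewrite inE => /andP[].
  have iso : nbh (W :\: D) w = set0.
    apply/setP => v; move/setP: xN => /(_ v); rewrite !inE => <-.
    by rewrite -andbA.
  apply: (@pdle_eq _ _ (divisible_upset (Z :|: D) (W :\: D :\ w))); first exact: divisible_isolated.
  have cw : #|W :\: D| = #|W :\: D :\ w|.+1 by rewrite (cardsD1 w) !inE wD wW.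
  have cDN : (#|D| <= #|W :\: D :\ w| + #|D|)%N by rewrite leq_addl.
  apply: IHk; first by move: ltk cWD cDW cw; clear; lia.
    rewrite -setI_eq0; apply/eqP/setP => v; move/disjointFr: dZW => /(_ v); rewrite !inE.
    by case: (v \in Z) => [->//|_] /=; case: (v \in D); rewrite /= ?andbF.
  rewrite cZD; apply: trade; first by move: cD Delta_gt0; clear; lia.
  by move: cWD cDW cw; clear; lia.
rewrite !inE => /andP[xD /andP[xW ewx]].
have xWD : x \in W :\: D by rewrite inE xD.
have xZ : x \notin Z by rewrite (disjointFl dZW xW).
have xZD : x \notin Z :|: D by rewrite inE negb_or xZ.
set N := nbh (W :\: D) x.
have cN : (#|N| <= Delta)%N by apply: nbh_card.
have sN : N \subset W :\: D by apply/subsetP => v; rewrite inE => /andP[].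
have xN : x \notin N by rewrite inE e_irr andbF.
have ltD : (#|D| < #|nbh W w|)%N.
  by apply: proper_card; apply/properP; split=> //; exists x; rewrite // inE xW.
have lt2 : (#|D| + #|N| + 1 <= Delta.*2)%N.
  by move: (nbh_card W w) cN ltD; clear; lia.
have cW : #|W| = (#|W :\: D :\: N :\ x| + #|N| + #|D| + 1)%N.
  have := subset_leq_card sN; have := cardsD (W :\: D) N.
  rewrite (setIidPr sN) (cardsD1 x (W :\: D :\: N)) [_ \in _ :\: _]inE xN xWD /=.
  move: cWD cDW; clear.
  by move: #|W :\: D :\: N :\ x| #|W :\: D| #|N| #|D| #|W|; lia.
have dZN : [disjoint Z :|: D & N].
  apply: disjointWr sN _; rewrite -setI_eq0; apply/eqP/setP => v.
  move/disjointFr: dZW => /(_ v); rewrite !inE.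
  by case: (v \in Z) => [->//|_] /=; [rewrite andbF | case: (v \in D)].
have cZN : #|Z :|: D :|: N| = (#|Z| + #|D| + #|N|)%N.
  by rewrite cardsU (disjoint_setI0 dZN) cards0 subn0 cZD.
apply: (@pdle_colon _ _ _ (divisible_upset ((Z :|: D) :|: N) (W :\: D :\: N :\ x))
   (divisible_upset (Z :|: (x |: D)) (W :\: (x |: D))) x).
- by move=> m; apply: divisible_colon.
- by move=> m; rewrite /= -divisible_add setUCA setDDl (setUC D).
- apply: IHk; first by move: ltk cW; clear; lia.
    rewrite -setI_eq0; apply/eqP/setP => v.
    move/disjointFr: dZW => /(_ v); rewrite !inE.
    case: (v \in Z) => [->//|_] /=; first by rewrite !andbF.
    case: (v \in D) => //=; first by rewrite !andbF.
    by case: (v \in W); rewrite ?andbF //=; case: (e x v); rewrite ?andbF.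
  rewrite cZN -addnA; apply: trade; first by move: lt2; clear; lia.
  by move: cW; clear; lia.
apply: IHj; last by rewrite subUset sub1set inE xW ewx.
have sub : nbh W w :\: (x |: D) \proper nbh W w :\: D.
  apply/properP; split; first by apply/setDS/subsetUr.
  by exists x; rewrite !inE ?eqxx // xD xW ewx.
by move: (proper_card sub) ltj; clear; lia.
Qed.
End Graph.

(** * The two bounds for edge ideals *)

Section EdgeIdealDimension.
Variables (n : nat) (K : fieldType) (e : rel 'I_n).
Hypotheses (e_sym : forall u v, e u v = e v u) (e_irr : irreflexive e).
Local Notation S := {mpoly K[n]}.
Local Notation edge_upset := (divisible_upset e finset.set0 [set: 'I_n]).

Lemma edge_upsetP (m : 'X_{1..n}) :
  reflect (exists u v, [/\ e u v, 0 < m u & 0 < m v]%N) (edge_upset m).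
Proof.
apply: (iffP (divisibleP _ _ _ _)) => [[[z]|[u [v [_ _ ? ? ?]]]]|[u [v [? ? ?]]]].
- by rewrite inE.
- by exists u, v.
- by right; exists u, v; rewrite !inE.
Qed.

Lemma edge_idealE : edge_ideal e =i @monideal n K edge_upset.
Proof.
move=> p; apply/asboolP/monidealP => [[c ->] m|pB].
  move/msupp_sum_le; rewrite filter_predT => /flattenP[_ /mapP[u _ ->]].
  move/msupp_sum_le => /flattenP[_ /mapP[v + ->]]; rewrite mem_filter => /andP[euv _].
  rewrite -mpolyXD => /msuppM_le/allpairsP[[a b] /= [_]].
  rewrite msuppX inE => /eqP -> ->; apply/edge_upsetP; exists u, v.
  by rewrite euv !mnmDE !mnm1E !eqxx !addnS.
suff : p \in edge_ideal e by move/asboolP.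
rewrite [p]mpolyE big_seq; apply: rpred_sum => m /pB/edge_upsetP[u [v [euv mu mv]]].
have uv : u != v by apply: contraTneq euv => ->; rewrite e_irr.
have -> : p@_m *: 'X_[m] = (p@_m *: 'X_[(m - (U_(u) + U_(v)))%MM]) * ('X_u * 'X_v) :> S.
  rewrite -scalerAl -!mpolyXD submK //; apply/mnm_lepP => i.
  rewrite mnmDE !mnm1E; case: (eqVneq u i) uv => [<-|ui] uv.
    by rewrite (eq_sym v) (negPf uv).
  by case: eqVneq => // <-.
apply: (@idealMr _ (edge_ideal e)); apply/asboolP; exists (fun a b => ((a == u) && (b == v))%:R).
rewrite (bigD1 u) //= [X in _ + X]big1 ?addr0 => [|a au]; last first.
  by apply: big1 => b _; rewrite (negPf au) mul0r.
rewrite (bigD1 v) //= [X in _ + X]big1 ?addr0 => [|b /andP[_ bv]]; last first.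
  by rewrite (negPf bv) andbF mul0r.
by rewrite !eqxx mul1r.
Qed.

Lemma presents_edge : presents (@monideal n K edge_upset) (edge_quotient K e).
Proof.
have [p sp kp] : presents (@edge_ideal K n e) (edge_quotient K e).
  exact: presents_quot.
by exists p => // a; rewrite kp edge_idealE.
Qed.

Lemma edge_pdle_upper (Delta l : nat) : (0 < Delta)%N ->
  (forall u, #|[set v | e u v]| <= Delta)%N ->
  (Delta.*2.-1 * n < Delta.*2 * l.+1)%N -> pdle l (edge_quotient K e).
Proof.
move=> D0 eD bnd; apply: (presents_pdle (quot_modP K edge_upset) presents_edge).
apply: (pdle_graph K e_sym e_irr D0 eD).
  by rewrite -setI_eq0 finset.set0I.
by rewrite cards0 muln0 add0n cardsT card_ord.
Qed.

(** The socle element is the product of the variables in T: it is outside the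
    ideal as T is independent, and killed by L as T dominates L. *)
Lemma edge_pdle_lower (L : seq 'I_n) (T : {pred 'I_n}) (l : nat) :
  uniq L -> {in T &, forall u v, ~~ e u v} ->
  {in L, forall i, exists2 t, t \in T & e i t} ->
  pdle l (edge_quotient K e) -> (size L <= l)%N.
Proof.
move=> uL indT covL pM; rewrite -(size_map (fun i : 'I_n => 'X_i : S)).
have [p _ kp] := presents_edge.
(* the exponent of the product of the variables in T *)
pose m := [multinom (i \in T : nat) | i < n].
apply: (socle_pdle (m := p ('X_[m] : S)) _ _ _ pM).
- by move=> P; apply: regular_vars.
- move=> _ /mapP[i /covL[t tT eit] ->]; rewrite -linearZ; apply/kp/monidealP => u.
  rewrite -[_ *: _]/('X_i * 'X_[m] : S) -mpolyXD msuppX inE => /eqP ->.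
  by apply/edge_upsetP; exists i, t; rewrite eit !mnmDE [m t]mnmE tT mnm1E eqxx addnS.
- move/kp/monidealP => /(_ m); rewrite msuppX mem_head => /(_ isT).
  case/edge_upsetP => u [v [euv]]; rewrite !mnmE !lt0b => uT vT.
  by rewrite (negPf (indT _ _ uT vT)) in euv.
Qed.

End EdgeIdealDimension.

(** * Plane forms on the lines through a point *)

Section Forms.
Variable F : numClosedFieldType.
Implicit Types (f g : {mpoly F[3]}) (u v w c : 'rV[F]_3) (p q : {poly F}).

(** The field is infinite. *)
Lemma poly_ext p q : (forall x, x != 0 -> p.[x] = q.[x]) -> p = q.
Proof.
move=> pq; apply/subr0_eq; set r := p - q.
apply: (@roots_geq_poly_eq0 _ r [seq i.+1%:R | i <- iota 0 (size r)]).
- apply/allP => _ /mapP[i _ ->]; rewrite /root hornerD hornerN pq ?subrr //.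
  by rewrite pnatr_eq0.
- rewrite map_inj_uniq ?iota_uniq // => i j /eqP; rewrite eqr_nat eqSS.
  by move/eqP.
- by rewrite size_map size_iota.
Qed.

(** By hypothesis p is the reversal of q regarded as a polynomial of degree D. *)
Lemma reciprocal D p q : (forall x, x != 0 -> p.[x] = x ^+ D * q.[x^-1]) ->
  (size p <= D.+1)%N /\ forall i, (i <= D)%N -> p`_i = q`_(D - i).
Proof.
move=> pq; pose N := maxn D (size q).
have DN : (D <= N)%N by apply: leq_maxl.
have e : p * 'X^(N - D) = \sum_(j < N.+1) q`_j *: 'X^(N - j).
  apply: poly_ext => x x0; rewrite hornerM hornerXn pq // mulrC mulrA -exprD subnK //.
  rewrite horner_sum (@horner_coef_wide _ N.+1 q) ?leqW ?leq_maxr // mulr_sumr.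
  apply: eq_bigr => j _; rewrite hornerZ hornerXn exprVn mulrCA; congr (_ * _).
  by rewrite expfB_cond // (negPf x0) /= -ltnS ltn_ord.
have pE i : p`_i = if (i <= D)%N then q`_(D - i) else 0.
  have -> : p`_i = (p * 'X^(N - D))`_(i + (N - D)) by rewrite coefMXn ltnNge leq_addl addnK.
  rewrite e coef_sum; under eq_bigr do rewrite coefZ coefXn.
  case: leqP => iD.
    have jN : (D - i < N.+1)%N by rewrite ltnS (leq_trans (leq_subr _ _)).
    rewrite (bigD1 (Ordinal jN)) //= (_ : (_ == _) = true) ?mulr1; last by apply/eqP; lia.
    rewrite big1 ?addr0 // => j /eqP jne; case: eqP => [h|_]; last by rewrite mulr0.
    by case: jne; apply: val_inj => /=; have := ltn_ord j; lia.
  rewrite big1 // => j _; case: eqP => [h|_]; last by rewrite mulr0.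
  by move: (leq_subr j N); lia.
split=> [|i iD]; last by rewrite pE iD.
by apply/leq_sizeP => i iD; rewrite pE leqNgt iD.
Qed.

Lemma rmorph_mmap (A B : comNzRingType) (phi : {rmorphism A -> B}) (h0 : F -> A)
    (h : 'I_3 -> A) f :
  phi (mmap h0 h f) = mmap (phi \o h0) (phi \o h) f.
Proof.
rewrite /mmap rmorph_sum; apply: eq_bigr => m _.
by rewrite rmorphM rmorph_prod; congr (_ * _); apply: eq_bigr => i _; rewrite rmorphXn.
Qed.

Lemma eq_mmap (A : comNzRingType) (h0 h0' : F -> A) (h h' : 'I_3 -> A) f :
  h0 =1 h0' -> h =1 h' -> mmap h0 h f = mmap h0' h' f.
Proof.
by move=> e0 e; apply: eq_bigr => m _; rewrite e0; congr (_ * _); apply: eq_bigr => i _; rewrite e.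
Qed.

(** The restriction of f to the line through w in the direction c. *)
Definition on_line f w c : {poly F} :=
  mmap polyC (fun i => (w 0 i)%:P + c 0 i *: 'X) f.

Lemma on_lineE f w c z : (on_line f w c).[z] = f.@[(w + z *: c) 0].
Proof.
rewrite -[LHS]/(horner_eval z _) rmorph_mmap; apply: eq_mmap => x /=.
  exact: hornerC.
by rewrite /horner_eval !hornerE !mxE mulrC.
Qed.

(** The family of the restrictions to the lines through u + x v in the direction
    c; the outer variable runs along the line, the inner one is x. *)
Definition on_pencil f u v c : {poly {poly F}} :=
  mmap (polyC \o polyC) (fun i => ((u 0 i)%:P + v 0 i *: 'X)%:P + (c 0 i)%:P *: 'X) f.

Lemma on_pencilE f u v c x :
  map_poly (horner_eval x) (on_pencil f u v c) = on_line f (u + x *: v) c.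
Proof.
rewrite rmorph_mmap; apply: eq_mmap => y /=; rewrite ?rmorphD /= ?map_polyC /=.
  by rewrite /horner_eval hornerC.
rewrite map_polyZ /= map_polyX /horner_eval !hornerE !mxE [v 0 y * x]mulrC.
by rewrite rmorphD.
Qed.

Section Homogeneous.
Variables (d : nat) (f : {mpoly F[3]}).
Hypothesis fd : f \is d.-homog.

Lemma homogE t v : f.@[(t *: v) 0] = t ^+ d * f.@[v 0].
Proof.
rewrite !mevalE mulr_sumr big_seq [RHS]big_seq; apply: eq_bigr => m mf.
have <- : mdeg m = d := dhomog_mf fd mf.
rewrite [RHS]mulrCA mdegE expr_sum -big_split; congr (_ * _); apply: eq_bigr => i _.
by rewrite mxE exprMn.
Qed.

Fact on_line_swap w c x : x != 0 ->
  (on_line f w c).[x] = x ^+ d * (on_line f c w).[x^-1].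
Proof.
by move=> x0; rewrite !on_lineE -homogE scalerDr scalerA divff // scale1r addrC.
Qed.

Lemma size_on_line w c : (size (on_line f w c) <= d.+1)%N.
Proof. by have [] := reciprocal (@on_line_swap w c). Qed.

Lemma on_line_lead w c : (on_line f w c)`_d = f.@[c 0].
Proof.
have [_ ->] // := reciprocal (@on_line_swap w c).
by rewrite subnn -horner_coef0 on_lineE scale0r addr0.
Qed.

Lemma on_line_scale t w c l : (on_line f (t *: w) c)`_l * t ^+ l = t ^+ d * (on_line f w c)`_l.
Proof.
have e : on_line f (t *: w) c \Po (t *: 'X) = t ^+ d *: on_line f w c.
  apply: poly_ext => x _; rewrite horner_comp hornerZ hornerZ hornerX !on_lineE.
  by rewrite -homogE scalerDr scalerA.
have -> : t ^+ d * (on_line f w c)`_l = (t ^+ d *: on_line f w c)`_l by rewrite coefZ.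
rewrite -e; move: (on_line f (t *: w) c) => p.
rewrite comp_polyE coef_sum.
have [ll|ll] := ltnP l (size p).
  rewrite (bigD1 (Ordinal ll)) //= big1 ?addr0 => [|j /eqP jne].
    by rewrite exprZn !coefZ coefXn eqxx mulr1.
  rewrite exprZn !coefZ coefXn; case: eqP => [h|]; last by rewrite !mulr0.
  by case: jne; apply: val_inj.
rewrite nth_default // mul0r big1 // => j _.
rewrite exprZn !coefZ coefXn gtn_eqF ?mulr0 //.
exact: leq_trans ll.
Qed.

End Homogeneous.
End Forms.

(** * Sylvester determinants and elimination *)

Section Sylvester.

Lemma det_val (R : comNzRingType) m n (A : 'M[R]_m) (B : 'M[R]_n) : m = n ->
  (forall (i j : 'I_m) (i' j' : 'I_n),
    i = i' :> nat -> j = j' :> nat -> A i j = B i' j') ->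
  \det A = \det B.
Proof. by move=> mn; subst m => AB; congr (\det _); apply/matrixP => i j; exact: AB. Qed.

(** The Sylvester matrix of p and q as polynomials of formal degree d: its size
    does not depend on p and q, so it can be specialised and rescaled freely. *)
Definition syl (R : nzRingType) d (p q : {poly R}) : 'M[R]_(d + d) :=
  \matrix_(i, j) if (i < d)%N then p`_(j - i) *+ (i <= j)
                 else q`_(j - (i - d)) *+ (i - d <= j).

Lemma resultant_syl (R : comNzRingType) d (p q : {poly R}) :
  size p = d.+1 -> size q = d.+1 -> resultant p q = \det (syl d p q).
Proof.
move=> sp sq; apply: det_val => [|i j i' j' ii jj]; first by rewrite sp sq.
have sd : (size q).-1 = d by rewrite sq.
rewrite Sylvester_mxE mxE -ii -jj; case: splitP => k ik /=; case: ifP => id.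
- by rewrite ik.
- by move: id; rewrite ik -sd ltn_ord.
- by move: id; rewrite ik -sd ltnNge leq_addr.
- by have -> : (i - d = k)%N by rewrite ik -sd addKn.
Qed.

Lemma map_syl (A B : comNzRingType) (phi : {rmorphism A -> B}) d p q :
  map_mx phi (syl d p q) = syl d (map_poly phi p) (map_poly phi q).
Proof.
by apply/matrixP => i j; rewrite !mxE; case: ifP => _; rewrite rmorphMn coef_map.
Qed.

(** Row i scales by t^(r i) and column j by t^(-j), and d^2 is the excess of the
    sum of the r i over the sum of the j. *)
Lemma det_syl_scale (R : idomainType) d (t : R) (p q p' q' : {poly R}) :
  t != 0 ->
  (forall l, p'`_l * t ^+ l = t ^+ d * p`_l) ->
  (forall l, q'`_l * t ^+ l = t ^+ d * q`_l) ->
  \det (syl d p' q') = t ^+ (d * d) * \det (syl d p q).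
Proof.
move=> t0 pp qq.
pose r (i : 'I_(d + d)) := (if i < d then d + i else i)%N.
have e : syl d p' q' *m diag_mx (\row_j t ^+ j) = diag_mx (\row_i t ^+ r i) *m syl d p q.
  apply/matrixP => i j; rewrite mul_mx_diag mul_diag_mx !mxE /r.
  case: ltnP => id; rewrite !mulrnAl !mulrnAr; case: leqP => ij; rewrite ?mulr0n ?mulr1n //.
    by rewrite -{2}(subnK ij) exprD mulrA pp exprD -!mulrA; congr (_ * _); rewrite mulrC.
  rewrite -{2}(subnK ij) exprD mulrA qq -{3}(subnKC id) exprD -!mulrA; congr (_ * _).
  by rewrite mulrC.
have := congr1 determinant e; rewrite !det_mulmx !det_diag.
under eq_bigr do rewrite mxE; under [in RHS]eq_bigr do rewrite mxE.
have -> : \prod_(i < d + d) t ^+ r i = t ^+ (d * d) * \prod_(i < d + d) t ^+ i.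
  rewrite !big_split_ord /= mulrA; congr (_ * _); last first.
    by apply: eq_bigr => i _; rewrite /r /= ltnNge leq_addr.
  rewrite (eq_bigr (fun i : 'I_d => t ^+ d * t ^+ i)); last first.
    by move=> i _; rewrite /r /= ltn_ord exprD.
  by rewrite big_split /= prodr_const card_ord -exprM.
move=> h; apply: (mulIf (x := \prod_(i < d + d) t ^+ i)).
  by apply/prodf_neq0 => i _; rewrite expf_neq0.
by rewrite h -!mulrA; congr (_ * _); rewrite mulrC.
Qed.

End Sylvester.

Section Pencil.
Variable F : numClosedFieldType.
Implicit Types (u v w c : 'rV[F]_3).
Variables (d : nat) (f g : {mpoly F[3]}).
Hypotheses (d_gt0 : (0 < d)%N) (fd : f \is d.-homog) (gd : g \is d.-homog).
Variable c : 'rV[F]_3.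
Hypotheses (fc : f.@[c 0] != 0) (gc : g.@[c 0] != 0).

(** It vanishes exactly when the line through w in the direction c carries a common
    zero of f and g. *)
Definition elim_res w : F := \det (syl d (on_line f w c) (on_line g w c)).

Lemma elim_res0 w :
  elim_res w = 0 <-> exists z, f.@[(w + z *: c) 0] = 0 /\ g.@[(w + z *: c) 0] = 0.
Proof.
have sz h : h \is d.-homog -> h.@[c 0] != 0 -> size (on_line h w c) = d.+1.
  move=> hd hc; apply/eqP; rewrite eqn_leq size_on_line //= ltnNge; apply: contra hc.
  by move=> le; rewrite -(on_line_lead hd w) nth_default.
rewrite /elim_res -resultant_syl ?sz //; split=> [/eqP|[z [fz gz]]].
  rewrite resultant_eq0 => lt.
  have /closed_rootP[z] : size (gcdp (on_line f w c) (on_line g w c)) != 1%N.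
    by rewrite gtn_eqF.
  by rewrite root_gcd => /andP[/rootP + /rootP]; rewrite !on_lineE; exists z.
apply/eqP; rewrite resultant_eq0 ltnNge; apply/negP => le.
have : root (gcdp (on_line f w c) (on_line g w c)) z.
  by rewrite root_gcd; apply/andP; split; apply/rootP; rewrite on_lineE.
rewrite (size1_polyC le) rootC -polyC_eq0 -(size1_polyC le) gcdp_eq0.
by rewrite -size_poly_eq0 sz.
Qed.

Lemma elim_res_scale t w : t != 0 -> elim_res (t *: w) = t ^+ (d * d) * elim_res w.
Proof. by move=> t0; apply: det_syl_scale => // l; apply: on_line_scale. Qed.

Definition eliminant u v : {poly F} :=
  \det (syl d (on_pencil f u v c) (on_pencil g u v c)).

Lemma eliminantE u v x : (eliminant u v).[x] = elim_res (u + x *: v).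
Proof.
rewrite -[LHS]/(horner_eval x _) -det_map_mx map_syl.
by rewrite /= !on_pencilE.
Qed.

(** The points u + x v and v + x^-1 u are proportional. *)
Fact eliminant_swap u v x : x != 0 ->
  (eliminant u v).[x] = x ^+ (d * d) * (eliminant v u).[x^-1].
Proof.
move=> x0; rewrite !eliminantE -elim_res_scale //.
by rewrite scalerDr scalerA divff // scale1r addrC.
Qed.

Lemma size_eliminant u v : (size (eliminant u v) <= (d * d).+1)%N.
Proof. by have [] := reciprocal (@eliminant_swap u v). Qed.

(** If the eliminant has no zero, it is a nonzero constant; its reversal then
    vanishes at 0, and the direction v at infinity carries a common zero. *)
Lemma eliminant_root u v :
  exists w z, [/\ w = v \/ (exists x, w = u + x *: v),
     f.@[(w + z *: c) 0] = 0 & g.@[(w + z *: c) 0] = 0].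
Proof.
have [/eqP s1|/closed_rootP[x /rootP]] := boolP (size (eliminant u v) == 1%N); last first.
  by rewrite eliminantE => /elim_res0[z [fz gz]]; exists (u + x *: v), z; split=> //; right; exists x.
have : (eliminant v u)`_0 = 0.
  have [_ ->] // := reciprocal (@eliminant_swap v u).
  by rewrite subn0 nth_default // s1 muln_gt0 d_gt0.
rewrite -horner_coef0 eliminantE scale0r addr0 => /elim_res0[z [fz gz]].
by exists v, z; split=> //; left.
Qed.

End Pencil.

Section Generic.
Variable F : numClosedFieldType.

Lemma digits E a b a' b' : (a < E)%N -> (a' < E)%N ->
  (a + E * b = a' + E * b')%N -> a = a' /\ b = b'.
Proof.
move=> aE aE' e; have E0 : (0 < E)%N by apply: leq_ltn_trans aE.
have em := congr1 (modn^~ E) e; have ed := congr1 (divn^~ E) e.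
move: em ed; rewrite /= ![(_ + E * _)%N]addnC ![(E * _)%N]mulnC !modnMDl !divnMDl //.
by rewrite !modn_small // !divn_small // !addn0.
Qed.

(** Kronecker substitution: with E above all exponents, putting t^(E^i) for the
    i-th variable separates the monomials of h. *)
Lemma nonvanishing (h : {mpoly F[3]}) : h != 0 -> exists w : 'rV[F]_3, h.@[w 0] != 0.
Proof.
move=> h0; pose E := msize h.
pose k (m : 'X_{1..3}) : nat := (\sum_(i < 3) m i * E ^ i)%N.
have kinj : {in msupp h &, injective k}.
  have lt m : m \in msupp h -> forall i, (m i < E)%N.
    move=> mh i; apply: leq_ltn_trans (msize_mdeg_lt mh).
    by rewrite mdegE (bigD1 i) //= leq_addr.
  have kE (m : 'X_{1..3}) : k m = (m (inord 0) + E * (m (inord 1) + E * m (inord 2)))%N.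
    rewrite /k !big_ord_recl big_ord0 !mulnDr addn0 expn0 muln1 /= expn1 mulnA mulnn.
    rewrite [(E * _)%N]mulnC [(E ^ 2 * _)%N]mulnC.
    by congr (m _ + (m _ * _ + m _ * _))%N; apply: val_inj; rewrite /= inordK.
  move=> m m' /lt ltm /lt ltm'; rewrite !kE => /digits[|//|e0] //.
  move/digits=> [|//|e1 e2] //; apply/mnmP => i.
  case: i => [[|[|[|//]]] lti].
  - by rewrite (_ : Ordinal lti = inord 0) //; apply: val_inj; rewrite /= inordK.
  - by rewrite (_ : Ordinal lti = inord 1) //; apply: val_inj; rewrite /= inordK.
  - by rewrite (_ : Ordinal lti = inord 2) //; apply: val_inj; rewrite /= inordK.
pose P : {poly F} := \sum_(m <- msupp h) h@_m *: 'X^(k m).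
have Pk m : m \in msupp h -> P`_(k m) = h@_m.
  move=> mh; rewrite coef_sum (bigD1_seq m) ?msupp_uniq //= big_seq_cond big1 ?addr0.
    by rewrite coefZ coefXn eqxx mulr1.
  move=> m' /andP[mh' ne]; rewrite coefZ coefXn; case: eqP => [|_]; last by rewrite mulr0.
  by move/(kinj _ _ mh mh') => e; rewrite e eqxx in ne.
have P0 : P != 0.
  have mh : mlead h \in msupp h by apply: mlead_supp.
  apply: contraTneq mh => P0; rewrite mcoeff_msupp negbK -Pk ?P0 ?coef0 //.
  exact: mlead_supp.
have [t Pt] : exists t, P.[t] != 0.
  apply: contrapT => all0; case/eqP: P0; apply: poly_ext => x _.
  by rewrite horner0; apply: contrapT => /eqP Px; apply: all0; exists x.
exists (\row_i t ^+ (E ^ i)); apply: contraNneq Pt => h0'; rewrite -h0' horner_sum mevalE.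
apply/eqP/eq_bigr => m _; rewrite hornerZ hornerXn; congr (_ * _).
rewrite /k expr_sum; apply: eq_bigr => i _; rewrite mxE -exprM mulnC.
by [].
Qed.

End Generic.

(** * Counting the common points of two plane curves *)

Section Bezout.
Variable F : numClosedFieldType.
Implicit Types (f g : {mpoly F[3]}) (u v w c : 'rV[F]_3) (q : P2 F).

(** A vector of homogeneous coordinates of the point q. *)
Definition rep q : 'rV[F]_3 := vpick (val q).

Lemma rep_neq0 q : rep q != 0.
Proof.
by rewrite vpick0 -dimv_eq0 (eqP (valP q)).
Qed.

Lemma val_rep q : val q = <[rep q]>%VS.
Proof.
apply/esym/eqP; rewrite eqEdim -memvE memv_pick (eqP (valP q)).
by rewrite dim_vline rep_neq0.
Qed.

Lemma rep_inj q q' t : rep q = t *: rep q' -> q = q'.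
Proof.
move=> e; apply: val_inj; apply/eqP; rewrite eqEdim (eqP (valP q)) (eqP (valP q')) leqnn andbT.
by rewrite [X in (X <= _)%VS]val_rep e -memvE memvZ // memv_pick.
Qed.

Fact pt_dim w : w != 0 -> \dim <[w]>%VS == 1%N.
Proof. by rewrite dim_vline => ->. Qed.
Definition pt w (w0 : w != 0) : P2 F := exist _ <[w]>%VS (pt_dim w0).

Lemma rep_pt w (w0 : w != 0) : exists2 t, t != 0 & rep (pt w0) = t *: w.
Proof.
have : rep (pt w0) \in val (pt w0) by apply: memv_pick.
case/vlineP => t e; exists t => //; apply: contraNneq (rep_neq0 (pt w0)).
by rewrite e => ->; rewrite scale0r.
Qed.

Lemma curve_rep d f q : f \is d.-homog -> curve f q <-> f.@[(rep q) 0] = 0.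
Proof.
move=> fd; split=> [|f0 v]; first by apply; apply: memv_pick.
by rewrite val_rep => /vlineP[t ->]; rewrite (homogE fd) f0 mulr0.
Qed.

Lemma curve_pt d f w (w0 : w != 0) : f \is d.-homog ->
  curve f (pt w0) <-> f.@[w 0] = 0.
Proof.
move=> fd; have [t t0 e] := rep_pt w0.
rewrite (curve_rep _ fd) e (homogE fd); split=> [/eqP|->]; last exact: mulr0.
by rewrite mulf_eq0 expf_eq0 (negPf t0) andbF => /eqP.
Qed.

Lemma common_normal w w' : exists a : 'I_3 -> F,
  [/\ exists i, a i != 0, \sum_i w 0 i * a i = 0 & \sum_i w' 0 i * a i = 0].
Proof.
have [n n0 [e e']] : exists2 n : 'rV[F]_3, n != 0 & n *m w^T = 0 /\ n *m w'^T = 0.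
  pose A := (col_mx w w')^T; exists (nz_row (kermx A)).
    rewrite nz_row_eq0 -mxrank_eq0 mxrank_ker -lt0n subn_gt0 ltnS mxrank_tr.
    exact: rank_leq_row.
  apply: eq_row_mx; rewrite -mul_mx_row -tr_col_mx row_mx0.
  exact/sub_kermxP/nz_row_sub.
exists (n 0); split; first exact/rV0Pn.
  have : (n *m w^T) 0 0 = 0 by rewrite e mxE.
  by rewrite mxE => h; rewrite -[RHS]h; apply: eq_bigr => i _; rewrite mxE mulrC.
have : (n *m w'^T) 0 0 = 0 by rewrite e' mxE.
by rewrite mxE => h; rewrite -[RHS]h; apply: eq_bigr => i _; rewrite mxE mulrC.
Qed.

(** The two forms, one coordinate and the planes spanned by pairs of points are
    finitely many hypersurfaces, so some c avoids them all.  The coordinate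
    serves to complete c to a basis by two vectors of the standard basis. *)
Lemma good_center f g (P : seq (P2 F)) : f != 0 -> g != 0 ->
  exists c, [/\ f.@[c 0] != 0, g.@[c 0] != 0, c 0 0 != 0 &
    forall q q' a b, q \in P -> q' \in P -> c != a *: rep q + b *: rep q'].
Proof.
move=> f0 g0.
have /choice[l lP] : forall qq : P2 F * P2 F, exists l : {mpoly F[3]}, l != 0 /\
    forall a b, l.@[(a *: rep qq.1 + b *: rep qq.2) 0] = 0.
  move=> [q q']; have [n [[i ni] e e']] := common_normal (rep q) (rep q').
  exists (\sum_j n j *: 'X_j); split.
    apply: contraNneq ni => /(congr1 (mcoeff U_(i)%MM)); rewrite raddf_sum mcoeff0 /=.
    rewrite (bigD1 i) //= big1 ?addr0 => [|j ji]; rewrite mcoeffZ mcoeffXU.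
      by rewrite eqxx mulr1 => ->.
    by rewrite (negPf ji) mulr0.
  move=> a b; rewrite raddf_sum /=.
  under eq_bigr do rewrite mevalZ mevalXU !mxE mulrC mulrDl -!mulrA.
  by rewrite big_split -!mulr_sumr /= e e' !mulr0 addr0.
pose h := f * g * 'X_(0 : 'I_3) * \prod_(q <- P) \prod_(q' <- P) l (q, q').
have [|c] := @nonvanishing F h.
  rewrite !mulf_neq0 //; last first.
    by rewrite prodf_seq_neq0; apply/allP => q _; rewrite prodf_seq_neq0;
       apply/allP => q' _; have [] := lP (q, q').
  by rewrite -msupp_eq0 msuppX.
rewrite !mevalM mevalXU !mulf_eq0 !negb_or => /andP[/andP[/andP[fc gc] c0] lc].
exists c; split=> // q q' a b qP q'P; apply: contraNneq lc => ->.
rewrite rmorph_prod prodf_seq_eq0; apply/hasP; exists q => //=.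
rewrite rmorph_prod prodf_seq_eq0; apply/hasP; exists q' => //=.
by have [_ ->] := lP (q, q').
Qed.

Section Coordinates.
Variable c : 'rV[F]_3.
Hypothesis c0 : c 0 0 != 0.

Let i1 : 'I_3 := inord 1.
Let i2 : 'I_3 := inord 2.
Definition ax1 : 'rV[F]_3 := delta_mx 0 i1.
Definition ax2 : 'rV[F]_3 := delta_mx 0 i2.
(** With [crd2], the coordinates along the first two vectors of the basis
    (ax1, ax2, c). *)
Definition crd1 w := w 0 i1 - c 0 i1 / c 0 0 * w 0 0.
Definition crd2 w := w 0 i2 - c 0 i2 / c 0 0 * w 0 0.

Lemma decomp w : w = crd1 w *: ax1 + crd2 w *: ax2 + (w 0 0 / c 0 0) *: c.
Proof.
apply/rowP => j; rewrite !mxE /crd1 /crd2 /i1 /i2.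
have [->|->|->] : [\/ j = 0, j = i1 | j = i2].
- case: j => [[|[|[|//]]] lt]; [apply: Or31|apply: Or32|apply: Or33];
  by apply: val_inj; rewrite /= ?inordK.
- rewrite -!val_eqE /= !inordK //= !mulr0 !add0r divfK //.
- by rewrite -!val_eqE /= !inordK //=; field.
- by rewrite -!val_eqE /= !inordK //=; field.
Qed.

Lemma crd1D a w w' : crd1 (a *: w + w') = a * crd1 w + crd1 w'.
Proof. by rewrite /crd1 !mxE mulrBr mulrDr opprD addrACA mulrCA. Qed.
Lemma crd2D a w w' : crd2 (a *: w + w') = a * crd2 w + crd2 w'.
Proof. by rewrite /crd2 !mxE mulrBr mulrDr opprD addrACA mulrCA. Qed.

Lemma crd_center : crd1 c = 0 /\ crd2 c = 0.
Proof. by rewrite /crd1 /crd2 !divfK // !subrr. Qed.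
Lemma crd_ax1 : crd1 ax1 = 1 /\ crd2 ax1 = 0.
Proof. by rewrite /crd1 /crd2 !mxE -!val_eqE /= !inordK //= !mulr0 !subr0. Qed.
Lemma crd_ax2 : crd1 ax2 = 0 /\ crd2 ax2 = 1.
Proof. by rewrite /crd1 /crd2 !mxE -!val_eqE /= !inordK //= !mulr0 !subr0. Qed.

End Coordinates.

Section Count.
Variables (d : nat) (f g : {mpoly F[3]}).
Hypotheses (d_gt0 : (0 < d)%N) (fd : f \is d.-homog) (gd : g \is d.-homog).
Hypotheses (f0 : f != 0) (g0 : g != 0).

(** A zero of the eliminant, possibly at infinity. *)
Lemma meet_nonempty : exists q, curve f q /\ curve g q.
Proof.
have [c [fc gc c0 _]] := good_center [::] f0 g0.
have [a1 b1] := crd_ax1 c; have [a2 b2] := crd_ax2 c; have [ac bc] := crd_center c0.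
have [w [z [wE fz gz]]] := eliminant_root d_gt0 fd gd fc gc ax1 ax2.
have w0 : w + z *: c != 0.
  apply/eqP => e; have a0 : crd1 c (w + z *: c) = 0 by rewrite e /crd1 !mxE mulr0 subrr.
  have b0 : crd2 c (w + z *: c) = 0 by rewrite e /crd2 !mxE mulr0 subrr.
  move: a0 b0; rewrite addrC crd1D crd2D ac bc !mulr0 !add0r.
  case: wE => [->|[x ->]]; first by move=> _ /eqP; rewrite b2 oner_eq0.
  by rewrite addrC crd1D a2 mulr0 add0r a1 => /eqP; rewrite oner_eq0.
by exists (pt w0); split; [apply/(curve_pt w0 fd) | apply/(curve_pt w0 gd)].
Qed.

(** Projection from a general point c embeds P into the zeros of the eliminant,
    which is nonzero since otherwise every direction would carry a point of P. *)
Lemma card_meet (P : seq (P2 F)) : uniq P ->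
  (forall q, q \in P <-> curve f q /\ curve g q) -> (size P <= d * d)%N.
Proof.
move=> uP PP.
have [c [fc gc c0 gen]] := good_center P f0 g0.
have [a1 b1] := crd_ax1 c; have [a2 b2] := crd_ax2 c; have [ac bc] := crd_center c0.
have frep q : q \in P -> f.@[(rep q) 0] = 0 /\ g.@[(rep q) 0] = 0.
  by move=> /PP[/(curve_rep _ fd) ? /(curve_rep _ gd)].
(* tau is chosen so that no point of P lies on the line at infinity of the
   pencil, which is spanned by v and c *)
pose T := \prod_(q <- P) ((crd1 c (rep q))%:P - crd2 c (rep q) *: 'X).
have T0 : T != 0.
  rewrite prodf_seq_neq0; apply/allP => q qP; apply/eqP => e.
  have aq : crd1 c (rep q) = 0.
    move/(congr1 (fun p : {poly F} => p`_0)): e.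
    by rewrite coefB coefC coefZ coefX /= mulr0 subr0 coef0.
  have bq : crd2 c (rep q) = 0.
    move/(congr1 (fun p : {poly F} => p`_1)): e.
    rewrite coefB coefC coefZ coefX /= mulr1 sub0r coef0.
    by move/eqP; rewrite oppr_eq0 => /eqP.
  have := gen q q 1 0 qP qP; have := frep q qP.
  have rE : rep q = (rep q 0 0 / c 0 0) *: c.
    by rewrite {1}(decomp c0 (rep q)) aq bq !scale0r !add0r.
  rewrite rE (homogE fd) => -[/eqP + _] _.
  rewrite mulf_eq0 (negPf fc) orbF expf_eq0 => /andP[_ /eqP k0].
  by have := rep_neq0 q; rewrite rE k0 scale0r eqxx.
have [tau tauP] : exists tau, T.[tau] != 0.
  apply: contrapT => all0; case/eqP: T0; apply: poly_ext => x _.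
  by rewrite horner0; apply: contrapT => /eqP Tx; apply: all0; exists x.
have A0 q : q \in P -> crd1 c (rep q) - tau * crd2 c (rep q) != 0.
  move=> qP; apply: contraNneq tauP => h; rewrite horner_prod prodf_seq_eq0.
  by apply/hasP; exists q => //=; rewrite !hornerE mulrC h.
pose A q := crd1 c (rep q) - tau * crd2 c (rep q).
pose v := ax2 + tau *: ax1.
pose x q := crd2 c (rep q) / A q.
pose y q := rep q 0 0 / c 0 0 / A q.
have rE q : q \in P -> rep q = A q *: (ax1 + x q *: v + y q *: c).
  move=> qP; rewrite {1}(decomp c0 (rep q)) !scalerDr !scalerA /x /y.
  rewrite ![A q * (_ / A q)]mulrC !divfK ?A0 // !addrA; congr (_ + _).
  rewrite addrAC; congr (_ + _).
  by rewrite -scalerDl /A [_ * tau]mulrC subrK.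
pose N := eliminant d f g c ax1 v.
have Nx q : q \in P -> N.[x q] = 0.
  move=> qP; rewrite eliminantE; apply/(elim_res0 fd gd fc gc); exists (y q).
  have := frep q qP; rewrite rE // (homogE fd) (homogE gd).
  have t0 : A q ^+ d != 0 by rewrite expf_neq0 ?A0.
  by move=> [/eqP + /eqP]; rewrite !mulf_eq0 (negPf t0) => /eqP ? /eqP ?.
(* equal directions with y q != y q' would put c in the plane of q and q' *)
have xinj : {in P &, injective x}.
  move=> q q' qP q'P e; have [yy|yy] := eqVneq (y q) (y q').
    apply: (@rep_inj _ _ (A q / A q')); rewrite [RHS](congr1 _ (rE q' q'P)) scalerA divfK ?A0 //.
    by rewrite (rE q qP) e yy.
  have := gen q q' ((y q - y q')^-1 / A q) (- ((y q - y q')^-1 / A q')) qP q'P.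
  rewrite {1}(rE q qP) {1}(rE q' q'P) scaleNr !scalerA !divfK ?A0 // -scalerBr e.
  rewrite [- (_ + _ *: c)]opprD addrACA subrr add0r -scalerBl scalerA mulVf ?subr_eq0 //.
  by rewrite scale1r eqxx.
(* otherwise the points Q t, one for each t, would all lie in P *)
have N0 : N != 0.
  apply/eqP => N0.
  have /choice[z zP] : forall t : F, exists z, f.@[(ax1 + t *: v + z *: c) 0] = 0 /\
      g.@[(ax1 + t *: v + z *: c) 0] = 0.
    move=> t; apply/(elim_res0 fd gd fc gc).
    by rewrite -/(elim_res d f g c _) -eliminantE -/N N0 horner0.
  pose w t := ax1 + t *: v + z t *: c.
  have wa t : crd1 c (w t) = 1 + t * tau.
    rewrite /w addrC crd1D ac mulr0 add0r addrC crd1D a1 /v addrC -[ax2 + _]addrC.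
    by rewrite crd1D a1 a2 addr0 mulr1 addrC.
  have wb t : crd2 c (w t) = t.
    rewrite /w addrC crd2D bc mulr0 add0r addrC crd2D b1 /v -[ax2 + _]addrC.
    by rewrite crd2D b1 b2 mulr0 add0r mulr1 addr0.
  have w0 t : w t != 0.
    apply/eqP => e; have a0 : crd1 c (w t) = 0 by rewrite e /crd1 !mxE mulr0 subrr.
    have b0 : crd2 c (w t) = 0 by rewrite e /crd2 !mxE mulr0 subrr.
    by move: a0; rewrite wa -(wb t) b0 mul0r addr0 => /eqP; rewrite oner_eq0.
  pose Q t := pt (w0 t).
  have Qinj : injective Q.
    move=> t t' e; have [s s0 es] := rep_pt (w0 t); have [s' s0' es'] := rep_pt (w0 t').
    have ww : w t = (s^-1 * s') *: w t'.
      by rewrite -scalerA -es' -[pt _]/(Q t') -e es scalerA mulVf // scale1r.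
    have eb : t = s^-1 * s' * t'.
      by rewrite -[LHS]wb ww -[_ *: _]addr0 crd2D wb /crd2 !mxE mulr0 subrr addr0.
    have : 1 + t * tau = s^-1 * s' * (1 + t' * tau).
      by rewrite -wa ww -[_ *: _]addr0 crd1D wa /crd1 !mxE mulr0 subrr addr0.
    by rewrite mulrDr mulr1 mulrA -eb => /addIr es1; rewrite eb -es1 mul1r.
  have QP t : Q t \in P.
    apply/PP; have [fz gz] := zP t.
    by split; [apply/(curve_pt _ fd) | apply/(curve_pt _ gd)].
  have : (size [seq Q i%:R | i <- iota 0 (size P).+1] <= size P)%N; last first.
    by rewrite size_map size_iota ltnn.
  apply: uniq_leq_size.
    rewrite map_inj_uniq ?iota_uniq // => i j /Qinj /eqP.
    by rewrite eqr_nat => /eqP.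
  by move=> _ /mapP[i _ ->].
have := max_poly_roots N0 (rs := [seq x q | q <- P]); rewrite size_map.
rewrite map_inj_in_uniq // uP => /(_ _ isT) lt.
have szN : (size N <= (d * d).+1)%N by apply: size_eliminant.
rewrite -ltnS; apply: leq_trans szN; apply: lt.
by apply/allP => _ /mapP[q qP ->]; apply/rootP/Nx.
Qed.

End Count.
End Bezout.

(** * Levi graphs of arrangements *)

Section Levi.
Variables (F : numClosedFieldType) (d k s : nat) (C : 'I_k -> {mpoly F[3]}).
Variable (p : 'I_s -> P2 F).
Hypotheses (d_gt0 : (0 < d)%N) (k_gt1 : (1 < k)%N).
Hypotheses (hC : d_arrangement C d) (p_inj : injective p).
Hypothesis p_range : range p = Sing C.
Local Notation G := (levi_graph C p).

Lemma levi_sym u v : G u v = G v u.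
Proof. by rewrite /levi_graph; case: (split u); case: (split v). Qed.

Lemma levi_irr : irreflexive G.
Proof. by move=> u; rewrite /levi_graph; case: (split u). Qed.

Lemma levi_pc l i : G (lshift k l) (rshift s i) = (p l \in curve (C i)).
Proof. by rewrite /levi_graph (unsplitK (inl l)) (unsplitK (inr i)). Qed.

Lemma levi_pp l l' : G (lshift k l) (lshift k l') = false.
Proof. by rewrite /levi_graph (unsplitK (inl l)) (unsplitK (inl l')). Qed.

Lemma levi_cc i i' : G (rshift s i) (rshift s i') = false.
Proof. by rewrite /levi_graph (unsplitK (inr i)) (unsplitK (inr i')). Qed.

Lemma arr_neq0 i : C i != 0.
Proof.
apply/eqP => Ci0; have sm : smooth (C i) by apply: (arr_smooth hC).
have [||j] := sm (delta_mx 0 0).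
- by apply/rV0Pn; exists 0; rewrite mxE !eqxx oner_eq0.
- by rewrite Ci0 meval0.
- by rewrite Ci0 raddf0 meval0 eqxx.
Qed.

Lemma SingP q : (exists l, q = p l) <-> Sing C q.
Proof. by rewrite -p_range; split=> [[l ->]|[l _ <-]]; [exists l | exists l]. Qed.

(** The common points of the two curves all occur among the p l, so there are
    finitely many and [card_meet] applies. *)
Lemma card_two_curves i j : i != j ->
  (#|[set l | (p l \in curve (C i)) && (p l \in curve (C j))]| <= d * d)%N.
Proof.
move=> ij; set A := [set l | _].
rewrite cardE -(size_map p).
apply: (card_meet (arr_homog hC i) (arr_homog hC j) (arr_neq0 i) (arr_neq0 j)).
  by rewrite map_inj_uniq // enum_uniq.
move=> q; split=> [/mapP[l + ->]|[qi qj]].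
  by rewrite mem_enum finset.inE => /andP[]; rewrite !in_setE.
have /SingP[l qE] : Sing C q by exists i, j.
rewrite qE; apply/map_f; rewrite mem_enum finset.inE -qE.
by apply/andP; split; rewrite in_setE.
Qed.

(** Every point of a curve in the Levi graph lies on one of the k - 1 other
    curves. *)
Lemma curve_degree i :
  (#|[set v | G (rshift s i) v]| <= d * d * k.-1)%N.
Proof.
pose A j := [set l | (p l \in curve (C i)) && (p l \in curve (C j))].
pose B := (\bigcup_(j | j != i) A j)%SET.
have BA : (#|B| <= \sum_(j < k | j != i) d * d)%N.
  rewrite /B; elim/big_ind2: _ => [|x1 x2 y1 y2 h1 h2|j ji]; first by rewrite cards0.
    by apply: leq_trans (leq_add h1 h2); apply: leq_card_setU.
  by apply: card_two_curves; rewrite eq_sym.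
have -> : (d * d * k.-1 = \sum_(j < k | j != i) d * d)%N.
  by rewrite sum_nat_const cardC1 card_ord mulnC.
apply: leq_trans BA; apply: leq_trans (leq_imset_card (lshift k) B).
apply/subset_leq_card/fintype.subsetP => v; rewrite finset.inE -[v]splitK.
case: (split v) => [l|i'] /=; last by rewrite levi_cc.
rewrite levi_sym levi_pc => li; apply/imset_f/bigcupP.
have [j ji lj] : exists2 j, j != i & p l \in curve (C j).
  have /SingP[a [b [ab pa pb]]] : exists l', p l = p l' by exists l.
  have [ai|ai] := eqVneq a i; last by exists a; rewrite // in_setE.
  by exists b; rewrite ?in_setE // -ai eq_sym.
by exists j => //; rewrite finset.inE li lj.
Qed.

Lemma point_degree l : t_ C p k = 0%N ->
  (#|[set v | G (lshift k l) v]| <= k.-1)%N.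
Proof.
move=> tk; pose A := [set i | p l \in curve (C i)].
have lt : (#|A| < k)%N.
  have := max_card (mem A); rewrite card_ord leq_eqVlt => /orP[/eqP Ak|//].
  have /card0_eq/(_ l) := tk; rewrite !inE => /negP; case.
  by apply/eqP; rewrite -[RHS]Ak; apply: eq_card => i; rewrite !finset.inE.
rewrite -ltnS prednK ?(ltnW k_gt1) //; apply: leq_ltn_trans lt.
apply: leq_trans (leq_imset_card (@rshift s k) A).
apply/subset_leq_card/fintype.subsetP => v; rewrite finset.inE -[v]splitK.
case: (split v) => [l'|i] /=; first by rewrite levi_pp.
by rewrite levi_pc => li; apply/imset_f; rewrite finset.inE.
Qed.

Lemma point_covered l : exists i, p l \in curve (C i).
Proof.
have /SingP[a [b [ab pa pb]]] : exists l', p l = p l' by exists l.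
by exists a; rewrite in_setE.
Qed.

(** A common point with any other curve of the arrangement will do. *)
Lemma curve_covered i : exists l, p l \in curve (C i).
Proof.
have [j ji] : exists j : 'I_k, j != i.
  apply/existsP; rewrite -negb_forall; apply/negP => /forallP all_i.
  have : (#|[set: 'I_k]| <= #|[set i]|)%N.
    by apply/subset_leq_card/fintype.subsetP => j _; rewrite finset.inE.
  by rewrite cardsT card_ord cards1 leqNgt k_gt1.
have [q [qi qj]] := meet_nonempty d_gt0 (arr_homog hC i) (arr_homog hC j)
  (arr_neq0 i) (arr_neq0 j).
have /SingP[l qE] : Sing C q by exists i, j; rewrite eq_sym.
by exists l; rewrite -qE in_setE.
Qed.

Variable K : fieldType.

Lemma levi_pdle_points n : pdle n (edge_quotient K G) -> (s <= n)%N.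
Proof.
move=> h; rewrite -[s]card_ord cardE -(size_map (lshift k)).
apply: (edge_pdle_lower levi_irr (T := [pred v : 'I_(s + k) | ~~ (v < s)%N]) _ _ _ h).
- by rewrite map_inj_uniq ?enum_uniq //; apply: lshift_inj.
- move=> u v; rewrite !inE -[u]splitK -[v]splitK.
  case: (split u) => [a|a]; rewrite /= ?ltn_ord // => _.
  by case: (split v) => [b|b]; rewrite /= ?ltn_ord // levi_cc.
- move=> _ /mapP[l _ ->]; have [i li] := point_covered l.
  by exists (rshift s i); rewrite ?levi_pc // inE /= -leqNgt leq_addr.
Qed.

Lemma levi_pdle_curves n : pdle n (edge_quotient K G) -> (k <= n)%N.
Proof.
move=> h; rewrite -[k]card_ord cardE -(size_map (@rshift s k)).
apply: (edge_pdle_lower levi_irr (T := [pred v : 'I_(s + k) | (v < s)%N]) _ _ _ h).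
- by rewrite map_inj_uniq ?enum_uniq //; apply: rshift_inj.
- move=> u v; rewrite !inE -[u]splitK -[v]splitK.
  case: (split u) => [a|a]; rewrite /= ?ltnNge ?leq_addr // => _.
  by case: (split v) => [b|b]; rewrite /= ?ltnNge ?leq_addr // levi_pp.
- move=> _ /mapP[i _ ->]; have [l li] := curve_covered i.
  by exists (lshift k l); rewrite 1?levi_sym ?levi_pc // inE /=.
Qed.

End Levi.

Theorem proposition7p2
  (R : realType) (d k : nat) (hd : (1 <= d)%N) (hk : (3 <= k)%N)
  (C : 'I_k -> {mpoly R[i][3]}) (hC : d_arrangement C d)
  (s : nat) (p : 'I_s -> P2 R[i])
  (p_inj : injective p) (p_range : range p = Sing C)
  (htk : t_ C p k = 0%N)
  (K : fieldType) :
  exists2 pd : nat,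
    is_projdim (edge_quotient K (levi_graph C p)) pd &
    (Num.ceil ((s + k)%:R / 2 : rat) <= pd%:Z) /\
    ((pd%:R : rat) <= (s + k)%:R * (1 - 1 / (2 * d%:R ^+ 2 * (k%:R - 1)))).
Proof.
pose G := levi_graph C p; pose D := (d * d * k.-1)%N.
have k1 : (1 < k)%N by apply: ltnW.
have D_gt0 : (0 < D)%N by rewrite !muln_gt0 hd /= -subn1 subn_gt0.
have degG u : (#|[set v | G u v]| <= D)%N.
  rewrite -[u]splitK; case: (split u) => [l|i] /=.
    by apply: leq_trans (point_degree k1 l htk) _; rewrite leq_pmull // muln_gt0 hd.
  exact: curve_degree.
(* the largest integer below the claimed bound *)
pose U := (D.*2.-1 * (s + k) %/ D.*2)%N.
have hU : has_resolution_le (edge_quotient K G) U.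
  apply: resolution_of_pdle.
  apply: (edge_pdle_upper K (@levi_sym _ _ _ C p) (@levi_irr _ _ _ C p) D_gt0 degG).
  by rewrite [X in (_ < X)%N]mulnC ltn_ceil // double_gt0.
have ex : exists n, `[< has_resolution_le (edge_quotient K G) n >].
  by exists U; apply/asboolP.
case: (ex_minnP ex) => pd /asboolP hpd min_pd.
have pdU : (pd <= U)%N by apply/min_pd/asboolP.
exists pd; first by split=> // m hm; apply/min_pd/asboolP.
have hp := pdle_of_resolution hpd.
have sp := levi_pdle_points p_range hp.
have kp := levi_pdle_curves hd k1 hC p_range hp.
split.
  rewrite ceil_le_int ler_pdivrMr // -[pd%:~R]/(pd%:R) -natrM ler_nat.
  by rewrite muln2 -addnn leq_add.
have le : (D.*2 * pd <= D.*2.-1 * (s + k))%N.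
  apply: leq_trans (leq_trunc_div (D.*2.-1 * (s + k)) D.*2).
  by rewrite mulnC leq_mul2r pdU orbT.
have DE : 2 * d%:R ^+ 2 * (k%:R - 1) = (D.*2)%:R :> rat.
  have -> : k%:R - 1 = (k.-1)%:R :> rat by rewrite -subn1 natrB // ltnW.
  by rewrite -natrX -!natrM /D -mul2n mulnn mulnA.
have D2 : 0 < (D.*2)%:R :> rat by rewrite ltr0n double_gt0.
have D_neq0 : (D.*2)%:R != 0 :> rat by rewrite lt0r_neq0.
rewrite DE -(ler_pM2l D2) mulrCA mulrBr mulr1 mul1r divff //.
rewrite -natrM mulrC -[D.*2 in X in _ <= (X - _) * _]prednK ?double_gt0 //.
by rewrite -natr1 addrK -natrM ler_nat.
Qed.
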